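(* Let $M\in\mathcal{W}_k(d)$ be $2$-neighbourly. Then the $g$-vector $(g_0,\dots,g_{d+1})$ of $M$ is related to its Betti numbers $\beta_i$ (with respect to any field) as follows: (a) if $d=2k$, then $g_{l+1}\ge\binom{d+2}{l+1}\sum_{i=1}^{l}(-1)^{l-i}\beta_i$ for $1\le l\le k-1$; (b) if $d\ge 2k+1$, then $g_{l+1}\ge\binom{d+2}{l+1}\sum_{i=1}^{l}(-1)^{l-i}\beta_i$ for $1\le l\le k$; (c) if $d\ge 2k+2$, then $g_{l+1}=\binom{d+2}{l+1}\sum_{i=1}^{l}(-1)^{l-i}\beta_i$ for $k\le l\le d-k-1$; and (d) if $d\ge 2k+2$, then $\beta_i=0$ for $k+1\le i\le d-k-1$.
   Context: All simplicial complexes are finite and abstract, with the empty set as a face. For a finite set $\alpha$, $\overline{\alpha}$ is the complex of all subsets of $\alpha$ and $\partial\alpha$ the complex of all proper subsets. The join $X\ast Y$ (disjoint vertex sets) has as faces the disjoint unions of a face of $X$ and a face of $Y$. The standard sphere $S^d_{d+2}$ is $\partial\alpha$ with $\#\alpha=d+2$. Complexes are identified up to isomorphism. Bistellar moves: if $X$ is $d$-dimensional and $\alpha,\beta$ are disjoint nonempty sets with $\dim\alpha+\dim\beta=d$ (where $\dim\alpha=\#\alpha-1$) such that the set of faces of $X$ contained in $\alpha\sqcup\beta$ is exactly $\overline{\alpha}\ast\partial\beta$, then $Y=(X\setminus(\overline\alpha\ast\partial\beta))\cup(\partial\alpha\ast\overline\beta)$ is obtained from $X$ by the bistellar move $\alpha\mapsto\beta$,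 of index $\dim\beta$ (if $\beta$ is a single vertex, it is a new vertex). For $0\le k\le d+1$, a $d$-dimensional complex is $k$-stellated if it is obtained from $S^d_{d+2}$ by a finite sequence of bistellar moves, each of index $<k$ ($S^d_{d+2}$ is the only $0$-stellated one). The link of a vertex $x$ in $X$ is $\{\alpha\in X: x\notin\alpha,\ \alpha\sqcup\{x\}\in X\}$. For $0\le k\le d$, $\mathcal{W}_k(d)$ is the class of connected $d$-dimensional simplicial complexes all of whose vertex links are $k$-stellated $(d-1)$-spheres. $X$ is $2$-neighbourly if any two vertices form an edge. $f_i(X)$ is the number of $i$-dimensional faces ($f_{-1}=1$), and $g_j(X)=\sum_{i=-1}^{j-1}(-1)^{j-i-1}\binom{d-i+1}{j-i-1}f_i(X)$ for $0\le j\le d+1$, $d=\dim X$. $\beta_i=\dim_{\mathbb{F}}H_i(M;\mathbb{F})$ for the chosen field $\mathbb{F}$. *)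

(* Defs.v *)
From mathcomp Require Import all_boot all_order all_algebra.
From mathcomp Require Import finmap.

Set Implicit Arguments.
Unset Strict Implicit.
Unset Printing Implicit Defensive.

Import Order.TTheory GRing.Theory Num.Theory.

Local Open Scope fset_scope.
Local Open Scope ring_scope.

(* Vertices are natural numbers: every finite complex is isomorphic to one on  *)
(* nat, and a fresh vertex is always available for a bistellar move of index   *)
(* 0.  The order on nat also provides the signs of the boundary operator.      *)
Notation face := {fset nat} (only parsing).
Notation complex := {fset {fset nat}} (only parsing).

Definition is_complex (X : complex) : Prop :=
  fset0 \in X /\ forall a b : face, a \in X -> b `<=` a -> b \in X.

Definition face_dim (a : face) : int := #|` a|%:Z - 1.

Definition complex_dim (X : complex) : int :=
  \big[Num.max/-1]_(a <- X) face_dim a.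

Definition simplex (a : face) : complex := fpowerset a.

Definition simplex_boundary (a : face) : complex := fpowerset a `\ a.

Definition cjoin (X Y : complex) : complex :=
  [fset a `|` b | a in X, b in Y].

Definition bistellar_move (a b : face) (X Y : complex) : Prop :=
  [/\ (a != fset0) && (b != fset0), fdisjoint a b,
      face_dim a + face_dim b = complex_dim X,
      [fset c in X | c `<=` a `|` b] = cjoin (simplex a) (simplex_boundary b)
    & Y = (X `\` cjoin (simplex a) (simplex_boundary b))
            `|` cjoin (simplex_boundary a) (simplex b)].

(* The dimension d is an integer because vertex links of 0-dimensional         *)
(* complexes have dimension -1.  The class is closed under isomorphism since   *)
(* the initial sphere and the new vertices carry arbitrary labels.             *)
Inductive stellated (k : nat) (d : int) : complex -> Prop :=
| stellated_sphere (a : face) :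
    #|` a|%:Z = d + 2 -> stellated k d (simplex_boundary a)
| stellated_move (X Y : complex) (a b : face) :
    stellated k d X -> face_dim b < k%:Z -> bistellar_move a b X Y ->
    stellated k d Y.

Definition vertices (X : complex) : {fset nat} := \bigcup_(a <- X) a.

Definition link (x : nat) (X : complex) : complex :=
  [fset a in X | (x \notin a) && (x |` a \in X)].

Definition adjacent (X : complex) : rel (vertices X) :=
  fun x y => [fset val x; val y] \in X.

Definition connected (X : complex) : Prop :=
  forall x y : vertices X, connect (@adjacent X) x y.

Definition in_W (k d : nat) (X : complex) : Prop :=
  [/\ (k <= d)%N, is_complex X, complex_dim X = d%:Z, connected X
    & forall x : nat, x \in vertices X -> stellated k (d%:Z - 1) (link x X)].

Definition two_neighbourly (X : complex) : Prop :=
  forall x y : nat, x \in vertices X -> y \in vertices X -> x != y ->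
    [fset x; y] \in X.

(* Faces with s vertices, that is of dimension s - 1. *)
Definition faces (X : complex) (s : nat) : complex :=
  [fset a in X | #|` a| == s].

(* The summation index is s = i + 1, where i >= -1 is the dimension. *)
Definition gvec (d : nat) (X : complex) (j : nat) : int :=
  \sum_(0 <= s < j.+1)
    (-1) ^+ (j - s) * 'C(d + 2 - s, j - s)%:Z * #|` faces X s|%:Z.

Section Homology.
Variables (F : fieldType) (X : complex).

(* Coefficient of b in the boundary of a, the vertices of a being listed in    *)
(* increasing order.                                                           *)
Definition incidence (a b : face) : F :=
  \sum_(x <- a | a `\ x == b) (-1) ^+ #|` [fset y in a | (y < x)%N]|.

(* Chains are row vectors: boundary i maps C_(i+1) to C_i by right             *)
(* multiplication.                                                             *)
Definition boundary (i : nat) :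
    'M[F]_(#|{: faces X i.+2}|, #|{: faces X i.+1}|) :=
  \matrix_(a, b) incidence (val (enum_val a)) (val (enum_val b)).

(* Unreduced homology: every 0-chain is a cycle. *)
Definition cycles (i : nat) : 'M[F]_#|{: faces X i.+1}| :=
  match i with
  | 0 => 1%:M
  | j.+1 => kermx (boundary j)
  end.

(* The rows of boundary i lie in the row space of cycles i, so the subtraction *)
(* is exact and computes the dimension of cycles modulo boundaries.            *)
Definition betti (i : nat) : nat := (\rank (cycles i) - \rank (boundary i))%N.

End Homology.

(* Main.v *)
(** Every alternating sum of (reduced) Betti numbers is an alternating count of
    faces minus the rank of a single boundary operator, so all the homology
    reduces to ranks.  Call that sum [D_l(X)], over degrees below [l].

    Deleting a vertex [x] gives [D_(l+1)(X) <= D_(l+1)(X - x) + D_l(lk x)].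
    Averaging over all vertex subsets with Beta weights (choose [p] uniformly in
    [0,1], then keep each vertex with probability [p]) turns this into a Morse
    inequality: [D_(l+1)(M)] is at most, up to a sign term, the sum over the
    vertices [x] of the mean value of [D_l] on the induced subcomplexes of [lk x].

    A bistellar move [a -> b] changes [D_l] of the subcomplex induced on [A] only
    when [A] meets [a u b] exactly in [a] or in [b], so it changes the mean value
    by a Beta weight depending on [#b] alone, while it changes the g-vector by
    [x^#b - x^#a].  Hence the mean value is bounded by an alternating sum of the
    g-numbers of the link, in degrees where [#a] is too large to interfere.
    Summing over the links telescopes to [g_(l+1)(M) / C(d+2,l+1)].  In the middle
    range the g-numbers of the links vanish, so two consecutive bounds add up to
    [beta_(l+1) <= 0] and both are equalities. *)
Require Import Defs.
From mathcomp Require Import all_boot all_order all_algebra.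
From mathcomp Require Import finmap.
From mathcomp Require Import zify ring lra.

Set Implicit Arguments.
Unset Strict Implicit.
Unset Printing Implicit Defensive.

Import Order.TTheory GRing.Theory Num.Theory.
Local Open Scope fset_scope.
Local Open Scope ring_scope.

(** * Ranks of boundary operators *)

(** The diagonal is a separate hypothesis because [R] may have 2-torsion, where antisymmetry alone
    does not make it vanish. *)
Lemma sum_antisym (R : zmodType) (T : Type) (s : seq T) (g : T -> T -> R) :
  (forall x, g x x = 0) -> (forall x y, g x y + g y x = 0) ->
  \sum_(x <- s) \sum_(y <- s) g x y = 0.
Proof.
move=> g0 gN; elim: s => [|z s IHs]; first by rewrite big_nil.
under eq_bigr do rewrite big_cons.
rewrite big_cons g0 add0r big_split /= IHs addr0 -big_split /=.
by rewrite big1.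
Qed.

Lemma sum_fset_eq (R : nmodType) (T : choiceType) (A : {fset T}) (f : T -> R) b :
  b \in A -> \sum_(a <- A | b == a) f a = f b.
Proof.
move=> bA; rewrite big_mkcond (big_fsetD1 b) //= eqxx big_seq big1 ?addr0 //.
by move=> a; rewrite !inE eq_sym => /andP[/negPf->].
Qed.

Section Incidence.
Variable F : fieldType.
Implicit Types (a b c e : {fset nat}) (x y : nat).

Definition vsign a x : F := (-1) ^+ #|` [fset y in a | (y < x)%N]|.

Lemma vsignD1 a x y : x \in a ->
  vsign (a `\ x) y = (if (x < y)%N then -1 else 1) * vsign a y.
Proof.
move=> xa; rewrite /vsign; case: ifP => xy.
  rewrite mulN1r (cardfsD1 x [fset z in a | (z < y)%N]) !inE xa xy /= add1n.
  rewrite exprS mulN1r opprK; congr (_ ^+ _); congr #|` _ |.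
  by apply/fsetP => z; rewrite !inE; case: eqP.
rewrite mul1r; congr (_ ^+ _); congr #|` _ |.
by apply/fsetP => z; rewrite !inE; case: (eqVneq z x) => [->|_] /=; rewrite ?xy ?andbF.
Qed.

Lemma incidence_eq0 a b : (forall x, x \in a -> a `\ x != b) ->
  incidence F a b = 0.
Proof.
move=> H; rewrite /incidence big_seq_cond big1 // => x /andP[/H nb eb].
by rewrite eb in nb.
Qed.

Lemma incidenceD1 a x : x \in a -> incidence F a (a `\ x) = vsign a x.
Proof.
move=> xa; rewrite /incidence big_mkcond (big_fsetD1 x) //= eqxx.
rewrite big_seq big1 ?addr0 // => y; rewrite !inE => /andP[yx ya].
case: eqP => // /fsetP/(_ y); by rewrite !inE eqxx yx ya.
Qed.

(** The boundary of a boundary vanishes: removing two vertices in either order gives the same face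
    with opposite signs. *)
Lemma incidence_incidence (O : {fset {fset nat}}) a c :
  (forall x, x \in a -> a `\ x \in O) ->
  \sum_(b <- O) incidence F a b * incidence F b c = 0.
Proof.
move=> aO; rewrite /incidence.
under eq_bigr do rewrite big_distrl /= big_mkcond /=.
rewrite exchange_big /=.
pose g x y := if [&& x \in a, y \in a, x != y & a `\ x `\ y == c]
  then vsign a x * vsign (a `\ x) y else 0.
rewrite -[RHS](@sum_antisym F _ a g).
- apply: eq_big_seq => x xa; rewrite -big_mkcond /= sum_fset_eq ?aO //.
  rewrite big_distrr /= [RHS](big_fsetD1 x) //= {1}/g eqxx !andbF add0r.
  rewrite big_mkcond big_seq [RHS]big_seq; apply: eq_bigr => y.
  rewrite !inE => /andP[yx ya].
  by rewrite /g xa ya (eq_sym x) yx /=.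
- by move=> x; rewrite /g eqxx !andbF.
move=> x y; rewrite /g.
have -> : a `\ y `\ x = a `\ x `\ y by apply/fsetP => z; rewrite !inE andbCA.
rewrite (eq_sym y x).
case xa: (x \in a); case ya: (y \in a); rewrite ?addr0 //=.
case: ifP; rewrite ?addr0 // => /andP[xy _].
rewrite !vsignD1 //; move: xy; case: ltngtP => // _ _; ring.
Qed.

End Incidence.

Section Chains.
Variable F : fieldType.
Implicit Types (O X Y E : {fset {fset nat}}) (a b c e : {fset nat}) (x y : nat).

(** Rows and columns are indexed by arbitrary families, so that faces can be added one at a time in
    a fixed chain space. *)
Definition chain_bd O a : 'rV[F]_#|{: O}| :=
  \row_j incidence F a (val (enum_val j)).

Definition bd_mx O E : 'M[F]_(#|{: E}|, #|{: O}|) :=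
  \matrix_(i, j) incidence F (val (enum_val i)) (val (enum_val j)).

Lemma row_bd_mx O E i : row i (bd_mx O E) = chain_bd O (val (enum_val i)).
Proof. by apply/rowP => j; rewrite !mxE. Qed.

Lemma chain_bd_sub O E a : a \in E -> (chain_bd O a <= bd_mx O E)%MS.
Proof.
move=> aE; apply: (eq_row_sub (enum_rank [`aE])).
by rewrite row_bd_mx enum_rankK.
Qed.

Lemma bd_mx_subP O E m (B : 'M_(m, _)) :
  (forall a, a \in E -> (chain_bd O a <= B)%MS) -> (bd_mx O E <= B)%MS.
Proof. by move=> H; apply/row_subP => i; rewrite row_bd_mx; apply/H/valP. Qed.

Lemma bd_mxU1 O E a : (bd_mx O (a |` E) :=: bd_mx O E + chain_bd O a)%MS.
Proof.
apply/eqmxP/andP; split.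
  apply: bd_mx_subP => c; rewrite !inE => /orP[/eqP->|cE].
    exact: addsmxSr.
  exact: submx_trans (chain_bd_sub _ cE) (addsmxSl _ _).
rewrite addsmx_sub chain_bd_sub ?fset1U1 // andbT.
by apply: bd_mx_subP => c cE; rewrite chain_bd_sub // !inE cE orbT.
Qed.

Definition chain_rank O E : nat := \rank (bd_mx O E).

Lemma chain_rank_mono O E E' : E `<=` E' -> (chain_rank O E <= chain_rank O E')%N.
Proof.
move=> /fsubsetP sEE'; apply/mxrankS/bd_mx_subP => a /sEE'.
exact: chain_bd_sub.
Qed.

Lemma chain_rankU1_dep O E a : (chain_bd O a <= bd_mx O E)%MS ->
  chain_rank O (a |` E) = chain_rank O E.
Proof. by move=> H; rewrite /chain_rank bd_mxU1 (addsmx_idPl H). Qed.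

Lemma chain_rankU1_pivot O E a b : b \in O -> incidence F a b != 0 ->
  (forall c, c \in E -> incidence F c b = 0) ->
  chain_rank O (a |` E) = (chain_rank O E).+1.
Proof.
move=> bO ab Eb; rewrite /chain_rank bd_mxU1 mxrank_disjoint_sum.
  rewrite -(addn1 (\rank (bd_mx O E))); congr addn; rewrite rank_rV.
  case: eqP => // /rowP/(_ (enum_rank [`bO])).
  by rewrite !mxE enum_rankK /= => /eqP; rewrite (negPf ab).
apply/eqP; rewrite -submx0; apply/rV_subP => v.
rewrite sub_capmx => /andP[/submxP[u ->] /sub_rVP[k ek]]; rewrite ek.
have /rowP/(_ (enum_rank [`bO])) := ek.
rewrite !mxE enum_rankK /= big1 => [/esym/eqP|i _]; last first.
  by rewrite !mxE enum_rankK /= Eb ?mulr0 // fsvalP.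
by rewrite mulf_eq0 (negPf ab) orbF => /eqP->; rewrite scale0r sub0mx.
Qed.

(** The extra columns are zero, so each matrix is the other one times a 0-1 selection matrix. *)
Lemma chain_rank_sub O O' E : O `<=` O' ->
  (forall a b, a \in E -> b \in O' -> b \notin O -> incidence F a b = 0) ->
  chain_rank O E = chain_rank O' E.
Proof.
move=> /fsubsetP sOO' H; apply/eqP; rewrite eqn_leq /chain_rank; apply/andP; split.
  pose P : 'M[F]_(#|{: O'}|, #|{: O}|) :=
    \matrix_(i, j) (val (enum_val i) == val (enum_val j))%:R.
  suff -> : bd_mx O E = bd_mx O' E *m P by apply: mxrankM_maxl.
  apply/matrixP => i j; rewrite !mxE.
  have jO : val (enum_val j) \in O' by apply/sOO'/valP.
  rewrite (bigD1 (enum_rank [`jO])) //= !mxE enum_rankK eqxx mulr1.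
  rewrite big1 ?addr0 // => t tj; rewrite !mxE; case: eqP => [e|]; last by rewrite mulr0.
  by case/eqP: tj; apply: enum_val_inj; rewrite enum_rankK; apply: val_inj.
pose P : 'M[F]_(#|{: O}|, #|{: O'}|) :=
  \matrix_(i, j) (val (enum_val i) == val (enum_val j))%:R.
suff -> : bd_mx O' E = bd_mx O E *m P by apply: mxrankM_maxl.
apply/matrixP => i j; rewrite !mxE.
case jO : (val (enum_val j) \in O); last first.
  rewrite H ?jO //; [|exact: valP..].
  rewrite big1 // => t _; rewrite !mxE; case: eqP => [e|]; last by rewrite mulr0.
  by case/idP: jO; rewrite -e; apply: valP.
rewrite (bigD1 (enum_rank [`jO])) //= !mxE enum_rankK eqxx mulr1.
rewrite big1 ?addr0 // => t tj; rewrite !mxE; case: eqP => [e|]; last by rewrite mulr0.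
by case/eqP: tj; apply: enum_val_inj; rewrite enum_rankK; apply: val_inj.
Qed.

End Chains.

(** * Elementary expansions, added faces and vertex links *)

Definition down_closed (X : {fset {fset nat}}) : Prop :=
  forall a b : {fset nat}, a \in X -> b `<=` a -> b \in X.

Definition deletion (x : nat) (X : {fset {fset nat}}) : {fset {fset nat}} :=
  [fset c in X | x \notin c].

Lemma in_faces X s c : (c \in faces X s) = (c \in X) && (#|` c| == s).
Proof. by rewrite !inE. Qed.

Lemma in_link x X c : (c \in link x X) = [&& c \in X, x \notin c & x |` c \in X].
Proof. by rewrite !inE. Qed.

Lemma facesU1 c X s :
  faces (c |` X) s = if #|` c| == s then c |` faces X s else faces X s.
Proof.
apply/fsetP => e; case: ifP => cs; rewrite !inE.
  by case: eqP => // ->; rewrite cs.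
by case: eqP => // ->; rewrite cs !andbF.
Qed.

Lemma deletion_closed x X : down_closed X -> down_closed (deletion x X).
Proof.
move=> HX a b; rewrite !inE => /andP[aX xa] ba; rewrite (HX _ _ aX ba) /=.
by apply: contra xa; apply: (fsubsetP ba).
Qed.

Lemma link_closed x X : down_closed X -> down_closed (link x X).
Proof.
move=> HX a b; rewrite !in_link => /and3P[aX xa xaX] ba.
rewrite (HX _ _ aX ba) (HX _ _ xaX) ?fsetUS // andbT.
by apply: contra xa; apply: (fsubsetP ba).
Qed.

Lemma sum_link (R : nmodType) x X (f : {fset nat} -> R) : down_closed X ->
  \sum_(c <- link x X) f (x |` c) = \sum_(c <- X | x \in c) f c.
Proof.
move=> HX; rewrite [RHS]big_fset_condE.
pose h (c : {fset nat}) := x |` c.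
have hK : {in link x X &, injective h}.
  move=> a b; rewrite !in_link => /and3P[_ xa _] /and3P[_ xb _].
  by move=> /(congr1 (fun c : {fset nat} => c `\ x)); rewrite /h !fsetU1K.
have -> : [fset c in X | x \in c] = [fset h c | c in link x X].
  apply/fsetP => c; rewrite !inE.
  apply/andP/imfsetP => [[cX xc]|[b /=]].
    exists (c `\ x); last by rewrite /h fsetD1K.
    by rewrite in_link fsetD1K // cX !inE eqxx /= !andbT (HX _ _ cX) ?fsubD1set.
  rewrite in_link => /and3P[_ _ xbX] ->; split=> //; exact: fset1U1.
by rewrite [RHS]big_imfset.
Qed.

Lemma sum_deletion_link (R : nmodType) x X (f : {fset nat} -> R) : down_closed X ->
  \sum_(c <- X) f c =
  \sum_(c <- deletion x X) f c + \sum_(c <- link x X) f (x |` c).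
Proof.
move=> HX; rewrite (sum_link x f HX) (bigID (fun c : {fset nat} => x \in c)) addrC /=.
by rewrite [in RHS]big_fset.
Qed.

(** A truncated Euler characteristic that counts the empty face; adding the exponents avoids
    truncated subtraction. *)
Definition alt_card (l : nat) (X : {fset {fset nat}}) : int :=
  \sum_(c <- X | (#|` c| <= l)%N) (-1) ^+ (l + #|` c|).

Lemma alt_cardU1 l c X : c \notin X ->
  alt_card l (c |` X) =
  (if (#|` c| <= l)%N then (-1) ^+ (l + #|` c|) else 0) + alt_card l X.
Proof.
by move=> cX; rewrite /alt_card big_mkcond big_fsetU1 //= -big_mkcond.
Qed.

Lemma alt_card_link l x X : down_closed X ->
  alt_card l.+1 X = alt_card l.+1 (deletion x X) + alt_card l (link x X).
Proof.
move=> HX; rewrite /alt_card big_mkcond (sum_deletion_link x) //=.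
rewrite -big_mkcond; congr (_ + _).
rewrite [RHS]big_mkcond big_seq [RHS]big_seq; apply: eq_bigr => c.
rewrite in_link => /and3P[_ xc _]; rewrite cardfsU1 xc add1n ltnS.
by case: ifP => // _; rewrite addSn addnS !exprS mulrA mulrNN mulr1 mul1r.
Qed.

Section MorseDefect.
Variable F : fieldType.
Implicit Types (O X Y S T : {fset {fset nat}}) (a b c e : {fset nat}).
Implicit Types (x y v l s : nat).

(** The index counts vertices: the operator goes from dimension [l] to [l - 1], and [l = 0] is the
    augmentation. *)
Definition bd_rank l X : nat := chain_rank F (faces X l) (faces X l.+1).

(* The alternating sum of the reduced Betti numbers below degree l: all ranks *)
(* of boundary operators but the last one cancel.                             *)
Definition alt_betti l X : int := alt_card l X - (bd_rank l X)%:Z.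

Lemma card_fsetD1 a x : x \in a -> #|` a| = (#|` a `\ x|).+1.
Proof. by move=> xa; rewrite (cardfsD1 x) xa. Qed.

(** Boundaries of faces of [X] stay in [X], so different complexes can be compared in one larger
    chain space. *)
Lemma bd_rankE O X l : down_closed X -> X `<=` O ->
  bd_rank l X = chain_rank F O (faces X l.+1).
Proof.
move=> HX /fsubsetP sXO; apply: chain_rank_sub.
  by apply/fsubsetP => c; rewrite in_faces => /andP[/sXO].
move=> a b; rewrite !in_faces => /andP[aX sa] _ Hb.
apply: incidence_eq0 => x xa; apply: contra Hb => /eqP <-.
by rewrite (HX _ _ aX) ?fsubD1set //= -eqSS -(card_fsetD1 xa).
Qed.

Lemma incidenceU1 a x : x \notin a -> incidence F (x |` a) a != 0.
Proof.
move=> xa; have {2}-> : a = (x |` a) `\ x by rewrite fsetU1K.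
by rewrite incidenceD1 ?fset1U1 // /vsign expf_neq0 // oppr_eq0 oner_eq0.
Qed.

(** An elementary expansion preserves reduced homology; for ranks, this is a comparison of the size
    of [a] with [l]. *)
Lemma alt_betti_add_pair l X a v : down_closed X ->
    down_closed ((v |` a) |` (a |` X)) -> a \notin X -> v \notin a ->
  alt_betti l ((v |` a) |` (a |` X)) = alt_betti l X.
Proof.
set t := v |` a; set T := t |` _ => HX HT aX va.
have ct : #|` t| = #|` a|.+1 by rewrite cardfsU1 va.
have ta : t != a by apply: contra va => /eqP <-; exact: fset1U1.
have tX : t \notin X by apply: contra aX => tX; apply: (HX _ _ tX); exact: fsubsetU1.
have sXT : X `<=` T by apply/fsubsetP => c cX; rewrite !inE cX !orbT.
have aT : a \in T by rewrite !inE eqxx orbT.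
have bdXa c : c \in X -> incidence F c a = 0.
  move=> cX; apply: incidence_eq0 => x xc; apply: contra aX => /eqP <-.
  by apply: (HX _ _ cX); rewrite fsubD1set.
rewrite /alt_betti (bd_rankE (O := T) _ HT) // (bd_rankE (O := T) _ HX) //.
rewrite /T alt_cardU1 ?inE ?negb_or ?ta // alt_cardU1 // !facesU1 ct eqSS.
rewrite addnS exprS mulN1r.
(* If [a] has [l] vertices, only [a] is counted and only [t] gives a row. The entry of this row at
   [a] is a pivot, so count and rank both rise by one. *)
have [al|al] := eqVneq #|` a| l.
  rewrite al ltnn leqnn eqn_leq ltnn addnn -signr_odd odd_double andbF .
  rewrite (@chain_rankU1_pivot F _ _ _ a) ?incidenceU1 //; first by rewrite expr0 -addn1 PoszD; lia.
  by move=> c; rewrite in_faces => /andP[/bdXa].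
have [al1|al1] := eqVneq #|` a| l.+1; last first.
  have -> : (#|` a| < l)%N = (#|` a| <= l)%N by lia.
  by case: ifP => _; rewrite ?addrA ?addNr !add0r.
rewrite chain_rankU1_dep ?al1 ?ltnn.
  by case: ifP => [|_]; [lia | rewrite !add0r].
have Dt x : x \in t -> t `\ x \in T.
  by move=> xt; apply: (HT t); rewrite ?fset1U1 ?fsubD1set.
have Dtc c := incidence_incidence F c Dt.
have itt : incidence F t t = 0.
  apply: incidence_eq0 => x xt; apply/eqP => /fsetP/(_ x).
  by rewrite xt !inE eqxx.
(* Here [a] gives a new row. As the boundary of the boundary of [t] is zero, this row is a
   combination of those of the other facets of [t], which lie in [X]. *)
have -> : chain_bd F T a =
    - (incidence F t a)^-1 *: (\sum_(b <- X) incidence F t b *: chain_bd F T b).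
  apply/rowP => j; rewrite !mxE summxE.
  under eq_bigr do rewrite !mxE.
  have := Dtc (val (enum_val j)).
  rewrite /T big_fsetU1 ?inE ?negb_or ?ta //= itt mul0r add0r big_fsetU1 //=.
  move/eqP; rewrite addrC addr_eq0 => /eqP->.
  by rewrite mulrNN mulrA mulVf ?mul1r // incidenceU1.
apply: scalemx_sub; rewrite big_seq; apply: summx_sub => b bX.
have [->|] := eqVneq (incidence F t b) 0; first by rewrite scale0r sub0mx.
move=> tb; apply/scalemx_sub/chain_bd_sub; rewrite in_faces bX /=.
apply: contraR tb => cb; apply/eqP/incidence_eq0 => x xt.
apply: contra cb => /eqP <-; by rewrite -eqSS -(card_fsetD1 xt) ct al1.
Qed.

(* T is reached from S by elementary expansions: pair each new face with the *)
(* face obtained by toggling v, in order of increasing size.                 *)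
Lemma alt_betti_expand l v S T : down_closed S -> down_closed T -> S `<=` T ->
    (forall c, c \in T -> c \notin S -> (v |` c \in T) && (c `\ v \notin S)) ->
  alt_betti l T = alt_betti l S.
Proof.
move=> HS HT; have [n] := ubnP #|` T `\` S|.
elim: n S HS => // n IHn S HS; rewrite ltnS => cn sST Htog.
have [TS0|/fset0Pn[c0 c0TS]] := eqVneq (T `\` S) fset0.
  by congr alt_betti; apply/eqP; rewrite eqEfsubset sST -fsetD_eq0 TS0 eqxx.
pose P m := has (fun c : {fset nat} => #|` c| == m) (enum_fset (T `\` S)).
have exP : exists m, P m by exists #|` c0|; apply/hasP; exists c0.
(* A new face [c] of minimal size has its proper faces in [S]. It avoids [v], since otherwise [c]
   without [v] would be in [S], against the toggling hypothesis. *)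
case: (ex_minnP exP) => m /hasP[c cTS /eqP cm] minm.
have minc e : e \in T -> (#|` e| < #|` c|)%N -> e \in S.
  move=> eT; rewrite cm; apply: contraLR => eS; rewrite -leqNgt minm //.
  by apply/hasP; exists e => //; rewrite inE eS eT.
move: (cTS); rewrite inE => /andP[cS cT].
have /andP[vcT cvS] := Htog _ cT cS.
have vc : v \notin c.
  apply/negP => vc; case/negP: cvS; apply: minc; first by apply: (HT _ _ cT); rewrite fsubD1set.
  by rewrite (card_fsetD1 vc).
have subc e : e `<=` c -> e != c -> e \in S.
  move=> ec nec; apply: minc; first exact: HT cT ec.
  by rewrite fproper_ltn_card // fproperEneq nec.
have subvc e : e `<=` v |` c -> (e == v |` c) || (e == c) || (e \in S).
  move=> evc; apply/contraT; rewrite !negb_or => /andP[/andP[e1 e2] eS].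
  have eT : e \in T := HT _ _ vcT evc.
  have /andP[_ /negP[]] := Htog _ eT eS.
  have evc' : e `\ v `<=` c by rewrite fsubDset.
  apply: subc => //; apply/eqP => ec.
  case/boolP: (v \in e) => ve.
    by case/eqP: e1; rewrite -ec fsetD1K.
  by case/eqP: e2; rewrite -ec mem_fsetD1.
have HS' : down_closed ((v |` c) |` (c |` S)).
  move=> a b; rewrite !inE => /or3P[/eqP->|/eqP->|aS] ba.
  - by have := subvc _ ba; rewrite orbA.
  - by have := subvc _ (fsubset_trans ba (fsubsetU1 _ _)); rewrite orbA.
  - by rewrite (HS _ _ aS ba) !orbT.
rewrite -(alt_betti_add_pair l HS HS' cS vc); apply: IHn => //.
- apply: leq_trans cn; apply: fproper_ltn_card; apply/andP; split; last first.
    apply/fsubsetPn; exists c => //; first by rewrite !inE eqxx !orbT.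
  by apply/fsubsetP => e; rewrite !inE !negb_or -!andbA => /and4P[_ _ -> ->].
- apply/fsubsetP => e; rewrite !inE => /or3P[/eqP->|/eqP->|] //.
  exact: (fsubsetP sST).
move=> e eT; rewrite !inE !negb_or => /and3P[e1 e2 eS].
have /andP[-> evS] := Htog _ eT eS; rewrite evS andbT /=; apply/andP; split.
  apply/eqP => /fsetP/(_ v); rewrite !inE eqxx. by [].
apply/eqP => ec; case/boolP: (v \in e) => ve.
  by case/eqP: e1; rewrite -ec fsetD1K.
by case/eqP: e2; rewrite -ec mem_fsetD1.
Qed.

(** A new face cannot lower the rank, so the change is at most its signed count. With more than
    [l + 1] vertices it is neither counted nor a row. *)
Lemma alt_betti_add_face l X c : down_closed X -> down_closed (c |` X) ->
    c \notin X ->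
  alt_betti l (c |` X) <=
    alt_betti l X + (if (#|` c| <= l)%N then (-1) ^+ (l + #|` c|) else 0) /\
  ((l.+1 < #|` c|)%N -> alt_betti l (c |` X) = alt_betti l X).
Proof.
move=> HX HcX cX; rewrite /alt_betti (bd_rankE (O := c |` X) _ HcX) //.
rewrite (bd_rankE (O := c |` X) _ HX) ?fsubsetU1 // alt_cardU1 // facesU1.
set A := alt_card _ _; set B := if _ then _ else _.
split.
  rewrite (addrC B) addrAC lerD2r lerB // lez_nat.
  apply: chain_rank_mono; case: ifP => // _; exact: fsubsetU1.
move=> lc; rewrite /B leqNgt (ltn_trans _ lc) // add0r.
by have -> : (#|` c| == l.+1) = false by lia.
Qed.

(** * Deletion and link of a vertex *)

Definition eta x c : F := (-1) ^+ #|` [fset z in c | (x < z)%N]|.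

Lemma etaD1 x c y : y \in c -> eta x (c `\ y) = (if (x < y)%N then -1 else 1) * eta x c.
Proof.
move=> yc; rewrite /eta; case: ifP => xy.
  rewrite mulN1r (cardfsD1 y [fset z in c | (x < z)%N]) !inE yc xy /= add1n.
  rewrite exprS mulN1r opprK; congr (_ ^+ _); congr #|` _ |.
  by apply/fsetP => z; rewrite !inE; case: eqP.
rewrite mul1r; congr (_ ^+ _); congr #|` _ |.
by apply/fsetP => z; rewrite !inE; case: (eqVneq z y) => [->|_] /=; rewrite ?xy ?andbF.
Qed.

Lemma eta_sqr x c : eta x c * eta x c = 1.
Proof. by rewrite /eta -expr2 sqrr_sign. Qed.

(** Inserting [x] shifts the positions of exactly the vertices above [x], which [eta] counts. So
    link and cone have the same operator up to signs of rows and columns. *)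
Lemma incidence_cone x a c : x \notin a -> x \notin c ->
  incidence F a c = eta x a * eta x c * incidence F (x |` a) (x |` c).
Proof.
move=> xa xc; rewrite [in RHS]/incidence [in RHS]big_mkcond big_fsetU1 //=.
have -> : ((x |` a) `\ x == x |` c) = false.
  by apply/eqP => /fsetP/(_ x); rewrite !inE eqxx.
rewrite add0r -big_mkcond big_distrr /= /incidence big_seq_cond.
rewrite [RHS]big_seq_cond.
have cE y : y \in a -> ((x |` a) `\ y == x |` c) = (a `\ y == c).
  move=> ya; have xy : x != y by apply: contraNneq xa => ->.
  apply/eqP/eqP => [|<-].
    move/(congr1 (fun e : {fset nat} => e `\ x)); rewrite fsetU1K // => <-.
    apply/fsetP => z; rewrite !inE; case: (eqVneq z x) => //= ->.
    by rewrite (negPf xa) andbF.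
  by apply/fsetP => z; rewrite !inE; case: (eqVneq z x) => //= ->; rewrite xy.
apply: eq_big => [y|y /andP[ya /eqP e]].
  by case ya: (y \in a) => //=; rewrite cE.
rewrite -!/(vsign F _ _).
have := vsignD1 F y (fset1U1 x a); rewrite fsetU1K // => ->.
rewrite -e etaD1 // mulrA; congr (_ * _).
by rewrite mulrAC eta_sqr mul1r.
Qed.

(** Rank-nullity for the projection [P] onto the faces containing [x]: the image contains the
    boundaries of the link, the kernel those of the deletion. *)
Lemma bd_rank_link l x X : down_closed X ->
  (bd_rank l.+1 (deletion x X) + bd_rank l (link x X) <= bd_rank l.+1 X)%N.
Proof.
move=> HX; set L := link x X.
have HL : down_closed L by apply: link_closed.
rewrite (bd_rankE (O := X) _ (deletion_closed HX)); last first.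
  by apply/fsubsetP => c; rewrite inE => /andP[].
rewrite (bd_rankE (O := L) _ HL) // (bd_rankE (O := X) _ HX) //.
pose P : 'M[F]_(#|{: X}|, #|{: L}|) :=
  \matrix_(i, j) ((val (enum_val i) == x |` val (enum_val j))%:R
                  * eta x (val (enum_val j))).
have PE a j : (chain_bd F X a *m P) 0 j =
    incidence F a (x |` val (enum_val j)) * eta x (val (enum_val j)).
  have : val (enum_val j) \in L by apply: valP.
  rewrite in_link => /and3P[_ _ jX].
  rewrite !mxE (bigD1 (enum_rank [`jX])) //= !mxE enum_rankK eqxx mul1r.
  rewrite big1 ?addr0 // => t tj; rewrite !mxE; case: eqP => [e|].
    by case/eqP: tj; apply: enum_val_inj; rewrite enum_rankK; apply: val_inj.
  by rewrite mul0r mulr0.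
rewrite /chain_rank; set A := bd_mx F X (faces X _).
rewrite -(mxrank_mul_ker A P) addnC; apply: leq_add; apply: mxrankS.
  apply: bd_mx_subP => a; rewrite in_faces in_link => /andP[/and3P[aX xa xaX] ca].
  have -> : chain_bd F L a = eta x a *: (chain_bd F X (x |` a) *m P).
    apply/rowP => j; rewrite [RHS]mxE PE mxE.
    have : val (enum_val j) \in L by apply: valP.
    rewrite in_link => /and3P[_ xj _].
    by rewrite (incidence_cone xa xj) mulrAC -mulrA.
  apply/scalemx_sub/submxMr/chain_bd_sub.
  by rewrite in_faces xaX cardfsU1 xa (eqP ca) /= add1n.
apply: bd_mx_subP => a; rewrite in_faces inE => /andP[/andP[aX xa] ca].
rewrite sub_capmx chain_bd_sub ?in_faces ?aX //; apply/sub_kermxP/rowP => j.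
rewrite PE mxE incidence_eq0 ?mul0r // => y ya.
apply: contra xa => /eqP/fsetP/(_ x); rewrite !inE eqxx /=.
by case/andP.
Qed.

Lemma alt_betti_link l x X : down_closed X ->
  alt_betti l.+1 X <= alt_betti l.+1 (deletion x X) + alt_betti l (link x X).
Proof.
move=> HX; rewrite /alt_betti (alt_card_link l x HX).
have := bd_rank_link l x HX; lia.
Qed.

End MorseDefect.

(** * Beta averages *)

Lemma sum_fset_const (R : nmodType) (T : choiceType) (V : {fset T}) (P : pred T)
    (k : R) : \sum_(x <- V | P x) k = k *+ #|` [fset x in V | P x]|.
Proof. by rewrite big_fset_condE big_const_seq count_predT iter_addr_0. Qed.

Lemma card_faces X s :
  (#|` faces X s|)%:Z = \sum_(c <- X) (if #|` c| == s then 1 else 0).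
Proof. by rewrite -big_mkcond big_fset_condE -sum1_size -natz natr_sum. Qed.

Lemma alt_card_recr l X :
  alt_card l X + alt_card l.+1 X = (#|` faces X l.+1|)%:Z.
Proof.
rewrite card_faces /alt_card big_mkcond [X in _ + X]big_mkcond -big_split /=.
apply: eq_bigr => c _; rewrite addSn exprS mulN1r.
have [cl|cl|->] := ltngtP #|` c| l.+1.
- by rewrite -ltnS cl addrN.
- by rewrite leqNgt (ltn_trans _ cl) // addr0.
- by rewrite ltnn add0r addnS exprS mulN1r opprK addnn -signr_odd odd_double.
Qed.

Lemma alt_card0 X : alt_card 0 X = (#|` faces X 0|)%:Z.
Proof.
rewrite card_faces /alt_card big_mkcond /=; apply: eq_bigr => c _.
by rewrite leqn0; case: eqP => // ->; rewrite expr0.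
Qed.

(** * Betti numbers from ranks *)

Section Betti.
Variable F : fieldType.
Implicit Types (X : {fset {fset nat}}).

Lemma bd_rank_recr l X : down_closed X ->
  (bd_rank F l X + bd_rank F l.+1 X <= #|` faces X l.+1|)%N.
Proof.
move=> HX; rewrite addnC cardfE; apply: mulmx0_rank_max.
apply/matrixP => i j; rewrite !mxE.
under eq_bigr do rewrite !mxE.
have := valP (enum_val i); rewrite /= in_faces => /andP[iX ci].
transitivity (\sum_(b <- faces X l.+1) incidence F (val (enum_val i)) b *
    incidence F b (val (enum_val j))).
  rewrite big_seq_fsetE [RHS](reindex (fun k : 'I_#|{: faces X l.+1}| => enum_val k)) //=.
  by exists enum_rank => x _; rewrite ?enum_valK ?enum_rankK.
apply: incidence_incidence => x xi; rewrite in_faces (HX _ _ iX) ?fsubD1set //=.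
by rewrite -eqSS -(card_fsetD1 xi).
Qed.

(** The sum is a reduced Betti number: only the faces with [l + 1] vertices do not cancel. *)
Lemma alt_betti_recr_ge0 l X : down_closed X ->
  0 <= alt_betti F l X + alt_betti F l.+1 X.
Proof.
move=> HX; rewrite /alt_betti addrACA alt_card_recr.
have := bd_rank_recr l HX; lia.
Qed.

Lemma alt_betti0_ge0 X : 0 <= alt_betti F 0 X.
Proof.
rewrite /alt_betti alt_card0 cardfE.
have : (bd_rank F 0 X <= #|{: faces X 0}|)%N by apply: rank_leq_col.
lia.
Qed.

(** Reduced and unreduced homology agree in positive degrees, whence the shift to [i.+1]. *)
Lemma bettiE i X : down_closed X ->
  (betti F X i.+1)%:Z = alt_betti F i.+1 X + alt_betti F i.+2 X.
Proof.
move=> HX; rewrite /alt_betti addrACA alt_card_recr /betti /= mxrank_ker.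
have rE j : \rank (boundary F X j) = bd_rank F j.+1 X by [].
by have := bd_rank_recr i.+1 HX; rewrite !rE cardfE; lia.
Qed.

(** The hypothesis on [alt_betti F 1 X] removes the reduced degrees -1 and 0, so the sum starts at
    1. *)
Lemma alt_betti_sum l X : down_closed X -> alt_betti F 1 X = 0 ->
  alt_betti F l.+1 X = \sum_(1 <= i < l.+1) (-1) ^+ (l - i) * (betti F X i)%:Z.
Proof.
move=> HX X1; elim: l => [|l IHl]; first by rewrite big_geq.
rewrite big_nat_recr //= subnn expr0 mul1r bettiE //.
suff -> : \sum_(1 <= i < l.+1) (-1) ^+ (l.+1 - i) * (betti F X i)%:Z =
    - alt_betti F l.+1 X by rewrite addKr.
rewrite IHl -sumrN; apply: eq_big_nat => i /andP[_ il].
by rewrite subSn // exprS mulN1r mulNr.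
Qed.

End Betti.

(** * Averages over random subsets *)

Lemma fpowerset_closed A : down_closed (fpowerset A).
Proof. by move=> a b; rewrite !fpowersetE => aA /fsubset_trans; apply. Qed.

Lemma deletion_fpowerset x A : deletion x (fpowerset A) = fpowerset (A `\ x).
Proof. by apply/fsetP => c; rewrite !inE !fpowersetE fsubsetD1. Qed.

Lemma link_fpowerset x A : x \in A -> link x (fpowerset A) = fpowerset (A `\ x).
Proof.
move=> xA; apply/fsetP => c; rewrite in_link !fpowersetE fsubsetD1 fsubUset fsub1set xA.
by case: (c `<=` A); rewrite ?andbF ?andbT.
Qed.

Lemma sum_fpowersetU1 (R : nmodType) v W (f : {fset nat} -> R) : v \notin W ->
  \sum_(A <- fpowerset (v |` W)) f A =
  \sum_(A <- fpowerset W) (f A + f (v |` A)).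
Proof.
move=> vW; rewrite (sum_deletion_link v) ?deletion_fpowerset; last exact: fpowerset_closed.
by rewrite link_fpowerset ?fset1U1 // fsetU1K // big_split.
Qed.

Lemma double_count_link (R : nmodType) V X (f : {fset nat} -> R) : down_closed X ->
    (forall c, c \in X -> c `<=` V) ->
  \sum_(x <- V) \sum_(c <- link x X) f (x |` c) = \sum_(c <- X) f c *+ #|` c|.
Proof.
move=> HX XV; under eq_bigr do rewrite sum_link // big_mkcond.
rewrite exchange_big /= big_seq [RHS]big_seq; apply: eq_bigr => c cX.
rewrite -big_mkcond sum_fset_const; congr (_ *+ #|` _|).
apply/fsetP => x; rewrite !inE.
by case xc: (x \in c); rewrite ?andbF // andbT (fsubsetP (XV _ cX)).
Qed.

(* The Beta integral [int_0^1 p^a (1-p)^(N-a) dp]: averaging over all subsets *)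
(* with these weights picks each point independently with a common random p.  *)
Definition beta_weight (N a : nat) : rat := (a`! * (N - a)`!)%:R / (N.+1)`!%:R.

Lemma fact_neq0 n : n`!%:R != 0 :> rat.
Proof. by rewrite pnatr_eq0 -lt0n fact_gt0. Qed.

Lemma beta_weight_ge0 N a : 0 <= beta_weight N a.
Proof. by rewrite divr_ge0 // ler0n. Qed.

(** Multiply the integrand by [p + (1 - p) = 1]: one more point is chosen or not. *)
Lemma beta_weightD N a : (a <= N)%N ->
  beta_weight N a = beta_weight N.+1 a + beta_weight N.+1 a.+1.
Proof.
move=> /subnKC <-; set m := (N - a)%N.
have h1 := fact_neq0 (a + m).+1.
have h2 : (a%:R + m%:R + 2 : rat) != 0 by rewrite -!natrD pnatr_eq0 addn2.
have -> : beta_weight (a + m).+1 a =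
    a`!%:R * ((m%:R + 1) * m`!%:R) / ((a%:R + m%:R + 2) * (a + m).+1`!%:R).
  rewrite /beta_weight subSn ?leq_addr // addKn [(_.+2)`!]factS [(m.+1)`!]factS.
  by rewrite !natrM -!natr1 natrD -addrA.
have -> : beta_weight (a + m).+1 a.+1 =
    ((a%:R + 1) * a`!%:R) * m`!%:R / ((a%:R + m%:R + 2) * (a + m).+1`!%:R).
  rewrite /beta_weight subSS addKn [(_.+2)`!]factS [(a.+1)`!]factS.
  by rewrite !natrM -!natr1 natrD -addrA.
rewrite /beta_weight addKn natrM; field.
by rewrite h1 h2.
Qed.

Definition beta_avg (W : {fset nat}) (phi : {fset nat} -> rat) : rat :=
  \sum_(A <- fpowerset W) beta_weight #|` W| #|` A| * phi A.

(** Points outside [U] are removed one at a time: two sets differing in [v] have the same value, and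
    their weights add by [beta_weightD]. *)
Lemma beta_avg_indep U W phi : U `<=` W ->
    (forall A, A `<=` W -> phi A = phi (A `&` U)) ->
  beta_avg W phi = beta_avg U phi.
Proof.
have [n] := ubnP #|` W `\` U|; elim: n W => // n IHn W; rewrite ltnS => cn sUW Hphi.
have [WU0|/fset0Pn[v]] := eqVneq (W `\` U) fset0.
  by congr beta_avg; apply/eqP; rewrite eqEfsubset sUW -fsetD_eq0 WU0 eqxx.
rewrite inE => /andP[vU vW].
have vW' : v \notin W `\ v by rewrite !inE eqxx.
transitivity (beta_avg (W `\ v) phi); last first.
  apply: IHn; last 1 first.
  - by move=> A AW; rewrite Hphi // (fsubset_trans AW) // fsubD1set.
  - apply: leq_trans cn; apply: fproper_ltn_card.
    have -> : W `\ v `\` U = (W `\` U) `\ v.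
      by apply/fsetP => z; rewrite !inE andbCA.
    by apply: fproperD1; rewrite inE vU.
  - by rewrite fsubsetD1 sUW.
rewrite /beta_avg -{1 2}(fsetD1K vW) sum_fpowersetU1 //.
rewrite big_seq [RHS]big_seq; apply: eq_bigr => A; rewrite fpowersetE => AW.
have vA : v \notin A by apply: contra vW'; apply: (fsubsetP AW).
have AW2 : A `<=` W := fsubset_trans AW (fsubD1set _ _).
rewrite (Hphi (v |` A)) ?fsubUset ?fsub1set ?vW //.
have -> : (v |` A) `&` U = A `&` U.
  apply/fsetP => z; rewrite !inE; case: (eqVneq z v) => [->|] //=.
  by rewrite (negPf vU) andbF.
rewrite -Hphi // -mulrDl !cardfsU1 vW' vA !add1n -beta_weightD //.
by rewrite fsubset_leq_card.
Qed.

Lemma beta_avg_trace U B W (k : rat) : B `<=` U -> U `<=` W ->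
  beta_avg W (fun A => if A `&` U == B then k else 0) =
  beta_weight #|` U| #|` B| * k.
Proof.
move=> sBU sUW; rewrite (@beta_avg_indep U) //; last first.
  by move=> A _; rewrite -fsetIA fsetIid.
rewrite /beta_avg (big_fsetD1 B) ?fpowersetE //= (fsetIidPl sBU) eqxx.
rewrite big_seq big1 ?addr0 // => A; rewrite !inE fpowersetE => /andP[AB AU].
by rewrite (fsetIidPl AU) (negPf AB) mulr0.
Qed.

Lemma ler_beta_avg W phi psi : (forall A, A `<=` W -> phi A <= psi A) ->
  beta_avg W phi <= beta_avg W psi.
Proof.
move=> H; rewrite /beta_avg big_seq [leRHS]big_seq; apply: ler_sum => A.
by rewrite fpowersetE => AW; rewrite ler_wpM2l ?beta_weight_ge0 ?H.
Qed.

Lemma beta_avgD W phi psi :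
  beta_avg W (fun A => phi A + psi A) = beta_avg W phi + beta_avg W psi.
Proof. by rewrite -big_split; apply: eq_bigr => A _; rewrite mulrDr. Qed.

(** The net coefficient of a [b]-element subset of [n + 1] points in the sum of all increments: a
    gain for each element, a loss for each other point. Only the full and the empty set survive. *)
Lemma beta_weight_balance n b : (b <= n.+1)%N ->
  beta_weight n b.-1 *+ b - beta_weight n b *+ (n.+1 - b) =
  (b == n.+1)%:R - (b == 0%N)%:R.
Proof.
have nz := fact_neq0; case: b => [_|b].
  rewrite mulr0n !sub0r subn0 /beta_weight subn0 fact0 mul1n -[_ *+ n.+1]mulr_natr.
  by rewrite mulrAC -natrM mulnC -factS divff.
rewrite eqSS ltnS subSS subr0 /= leq_eqVlt => /orP[/eqP->|bn].
  rewrite subnn mulr0n subr0 eqxx /beta_weight subnn fact0 muln1.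
  by rewrite -[_ *+ n.+1]mulr_natr mulrAC -natrM mulnC -factS divff.
rewrite ltn_eqF // -(subnKC bn); set m := (n - b.+1)%N.
have e1 : (b.+1 + m - b = m.+1)%N by lia.
rewrite /beta_weight addKn e1 /=.
rewrite -[X in X - _]mulr_natr -[X in _ - X]mulr_natr.
rewrite mulrAC [X in _ - X]mulrAC -!natrM.
have -> : (b`! * (m.+1)`! * b.+1 = (b.+1)`! * m`! * m.+1)%N.
  by rewrite !factS; lia.
exact: subrr.
Qed.

(* Efficiency of the Shapley value. *)
Lemma beta_avg_telescope (V : {fset nat}) (phi : {fset nat} -> rat) :
  \sum_(x <- V) beta_avg (V `\ x) (fun A => phi (x |` A) - phi A) =
  phi V - phi fset0.
Proof.
have [->|V0] := eqVneq V fset0; first by rewrite big_seq_fset0 subrr.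
have [n cV] : exists n, #|` V| = n.+1.
  by exists #|` V|.-1; rewrite prednK // cardfs_gt0.
pose g (B : {fset nat}) := beta_weight n #|` B|.-1 * phi B.
pose h (B : {fset nat}) := beta_weight n #|` B| * phi B.
transitivity (\sum_(x <- V) \sum_(A <- link x (fpowerset V)) g (x |` A)
  - \sum_(x <- V) \sum_(A <- fpowerset V | x \notin A) h A).
  rewrite -sumrB; apply: eq_big_seq => x xV.
  rewrite link_fpowerset // [X in _ - X]big_fset_condE.
  have -> : [fset A in fpowerset V | x \notin A] = fpowerset (V `\ x).
    exact: deletion_fpowerset.
  rewrite -sumrB /beta_avg; apply: eq_big_seq => A; rewrite fpowersetE => AV.
  have xA : x \notin A by apply: contraTN xV => /(fsubsetP AV); rewrite !inE eqxx.
  have -> : #|` V `\ x| = n by apply: succn_inj; rewrite -card_fsetD1.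
  by rewrite /g /h cardfsU1 xA mulrBr.
rewrite double_count_link; [|exact: fpowerset_closed|by move=> c; rewrite fpowersetE].
under [X in _ - X]eq_bigr do rewrite big_mkcond.
rewrite exchange_big /= -sumrB.
transitivity (\sum_(B <- fpowerset V)
  ((if V == B then phi B else 0) - (if fset0 == B then phi B else 0))).
  apply: eq_big_seq => B; rewrite fpowersetE => BV.
  have -> : \sum_(x <- V) (if x \notin B then h B else 0) = h B *+ (n.+1 - #|` B|).
    rewrite -big_mkcond sum_fset_const -cV -cardfsDS //; congr (_ *+ #|` _|).
    by apply/fsetP => x; rewrite !inE andbC.
  have cB : (#|` B| <= n.+1)%N by rewrite -cV fsubset_leq_card.
  transitivity (((#|` B| == n.+1)%:R - (#|` B| == 0%N)%:R) * phi B).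
    by rewrite -beta_weight_balance // /g /h mulrBl !mulrnAl.
  have -> : (#|` B| == n.+1) = (V == B).
    by rewrite -cV [V == B]eq_sym eqEfcard BV eqn_leq (fsubset_leq_card BV).
  rewrite cardfs_eq0 [B == fset0]eq_sym mulrBl.
  by case: eqP; case: eqP; rewrite ?mul1r ?mul0r.
by rewrite sumrB -!big_mkcond !sum_fset_eq // fpowersetE.
Qed.

(** * Bistellar moves preserve strongly connected pseudomanifolds *)

Lemma fdisjointFl (K : choiceType) (A B : {fset K}) x :
  fdisjoint A B -> x \in B -> (x \in A) = false.
Proof. by rewrite fdisjoint_sym => /fdisjointP H /H/negPf. Qed.

Lemma fdisjointFr (K : choiceType) (A B : {fset K}) x :
  fdisjoint A B -> x \in A -> (x \in B) = false.
Proof. by move=> /fdisjointP H /H/negPf. Qed.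

Lemma codim1_setD1 (p S : {fset nat}) : p `<=` S -> #|` p|.+1 = #|` S| ->
  exists2 y, y \in S & p = S `\ y.
Proof.
move=> pS cp; have : p `<` S by rewrite fproperEcard pS -cp ltnS leqnn.
rewrite fproperE => /andP[_ /fsubsetPn[y yS yp]]; exists y => //.
apply/eqP; rewrite eqEfcard fsubsetD1 pS yp /=.
by rewrite -ltnS -(card_fsetD1 yS) cp.
Qed.

Lemma mem_cjoin (a b c : {fset nat}) : fdisjoint a b ->
  (c \in cjoin (simplex a) (simplex_boundary b)) = (c `<=` a `|` b) && ~~ (b `<=` c).
Proof.
move=> dab; apply/imfset2P/andP => [[e /= ea [f /= fb ->]]|[cab bc]].
  move: ea fb; rewrite !inE !fpowersetE => ea /andP[nf fb]; split.
    exact: fsetUSS.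
  apply: contra nf => bef; rewrite eqEfsubset fb /=.
  apply/fsubsetP => x xb; have := fsubsetP bef _ xb; rewrite inE => /orP[xe|//].
  by have := fsubsetP ea _ xe; rewrite (fdisjointFl dab xb).
exists (c `&` a); first by rewrite fpowersetE fsubsetIr.
exists (c `&` b); last by rewrite -fsetIUr; apply/esym/fsetIidPl.
rewrite !inE fpowersetE fsubsetIr andbT; apply: contra bc => /eqP e.
by rewrite -e fsubsetIl.
Qed.

Lemma cjoinC X Y : cjoin X Y = cjoin Y X.
Proof.
by apply/fsetP => c; apply/imfset2P/imfset2P => -[e eX [f fY ->]];
  exists f => //; exists e => //; rewrite fsetUC.
Qed.

(* Inside the simplex on a u b, X consists of the faces not containing b and Y *)
(* of those not containing a; outside of it they agree.                        *)
Record flip (d : nat) (a b : {fset nat}) (X Y : {fset {fset nat}}) : Prop := Flip {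
  flip_a0 : a != fset0;
  flip_b0 : b != fset0;
  flip_dis : fdisjoint a b;
  flip_card : (#|` a| + #|` b| = d.+1)%N;
  flip_memX : forall c, c `<=` a `|` b -> (c \in X) = ~~ (b `<=` c);
  flip_memY : forall c, (c \in Y) = if c `<=` a `|` b then ~~ (a `<=` c) else c \in X }.

Section SphereLike.
Variable d : nat.
Implicit Types (X Y : {fset {fset nat}}) (a b c p q r s t : {fset nat}).
Implicit Types (rho sigma : {fset nat}) (x y z : nat).

(** Here [d] is the number of vertices of a facet, so the dimension is [d - 1], as for the links in
    a [d]-dimensional complex. The facet is taken in the star of [sigma]. *)
Definition facet X sigma p := [&& p \in X, #|` p| == d & sigma `<=` p].

Definition pure X := forall c, c \in X -> exists q, facet X c q.

Definition thin X := forall rho p q r, #|` rho|.+1 = d ->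
  facet X rho p -> facet X rho q -> facet X rho r -> [|| p == q, p == r | q == r].

(** Connectedness of the dual graph of each star, expressed by predicates invariant under crossing a
    ridge instead of paths. *)
Definition star_connected X := forall sigma (C : pred {fset nat}), sigma \in X ->
  (forall p q, facet X sigma p -> facet X sigma q -> (d <= #|` p `&` q|.+1)%N ->
    C p -> C q) ->
  forall p q, facet X sigma p -> facet X sigma q -> C p -> C q.

Record sphere_like X : Prop := SphereLike {
  sl_complex : is_complex X; sl_pure : pure X; sl_thin : thin X;
  sl_conn : star_connected X }.

Lemma card_setI_codim1 (S p q : {fset nat}) : #|` S| = d.+1 -> p `<=` S -> q `<=` S ->
  #|` p| = d -> #|` q| = d -> (d <= #|` p `&` q|.+1)%N.
Proof.
move=> cS pS qS cp cq; have := cardfsUI p q; rewrite cp cq.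
have : (#|` p `|` q| <= d.+1)%N by rewrite -cS fsubset_leq_card // fsubUset pS.
lia.
Qed.

Lemma ridge_setD1 p q : #|` p| = d -> #|` q| = d -> (d <= #|` p `&` q|.+1)%N -> p != q ->
  exists2 z, z \in p & p `&` q = p `\ z.
Proof.
move=> cp cq cpq pq; apply: codim1_setD1; first exact: fsubsetIl.
apply/eqP; rewrite eqn_leq cp cpq andbT ltn_neqAle -{2}cp fsubset_leq_card ?fsubsetIl // andbT.
apply: contra pq => /eqP e.
have eI : p `&` q = p by apply/eqP; rewrite eqEfcard fsubsetIl cp e leqnn.
by rewrite eqEfcard -{1}eI fsubsetIr cp cq leqnn.
Qed.

(** Each facet omits one vertex of [S], and only two vertices of [S] lie outside [rho]. *)
Lemma thin_in_simplex (S rho p q r : {fset nat}) : #|` S| = d.+1 -> #|` rho|.+1 = d ->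
  [&& p `<=` S, #|` p| == d & rho `<=` p] -> [&& q `<=` S, #|` q| == d & rho `<=` q] ->
  [&& r `<=` S, #|` r| == d & rho `<=` r] -> [|| p == q, p == r | q == r].
Proof.
move=> cS cr /and3P[pS /eqP cp rp] /and3P[qS /eqP cq rq] /and3P[rS /eqP c3 rr].
have sub e : e `<=` S -> #|` e| = d -> exists2 y, y \in S & e = S `\ y.
  by move=> eS ce; apply: codim1_setD1; rewrite ?ce ?cS.
have [x xS ep] := sub _ pS cp; have [y yS eq] := sub _ qS cq.
have [z zS er] := sub _ rS c3.
have [//|pq] := eqVneq p q.
have [//|pr] := eqVneq p r.
have [//|qr] := eqVneq q r.
have xy : x != y by apply: contra pq => /eqP e; rewrite ep eq e.
have xz : x != z by apply: contra pr => /eqP e; rewrite ep er e.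
have yz : y != z by apply: contra qr => /eqP e; rewrite eq er e.
have : rho `<=` S `\ x `\ y `\ z.
  rewrite !fsubsetD1 (fsubset_trans rp pS) /=.
  have := rp; have := rq; have := rr; rewrite ep eq er !fsubsetD1.
  by move=> /andP[_ ->] /andP[_ ->] /andP[_ ->].
move/fsubset_leq_card.
have := card_fsetD1 xS.
have := @card_fsetD1 (S `\ x) y; rewrite !inE eq_sym xy yS => /(_ isT).
have := @card_fsetD1 (S `\ x `\ y) z; rewrite !inE eq_sym yz eq_sym xz zS => /(_ isT).
move=> e3 e2; rewrite cS e2 e3 => -[ed].
by rewrite -ltnS cr ed ltnn.
Qed.

Lemma sphere_like_boundary a : #|` a| = d.+1 -> sphere_like (simplex_boundary a).
Proof.
move=> ca; have memE c : (c \in simplex_boundary a) = (c != a) && (c `<=` a).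
  by rewrite !inE fpowersetE.
have inS c p : facet (simplex_boundary a) c p -> [&& p `<=` a, #|` p| == d & c `<=` p].
  by case/and3P; rewrite memE => /andP[_ ->] -> ->.
split.
- split; first by rewrite memE fsub0set andbT eq_sym -cardfs_gt0 ca.
  move=> c e; rewrite !memE => /andP[nca sca] ec; rewrite (fsubset_trans ec) // andbT.
  by apply: contra nca => /eqP e1; rewrite eqEfsubset sca -e1.
- move=> c; rewrite memE => /andP[nca sca].
  have : c `<` a by rewrite fproperEneq nca.
  rewrite fproperE => /andP[_ /fsubsetPn[y ya yc]]; exists (a `\ y).
  have nay : a `\ y != a by apply/eqP => /fsetP/(_ y); rewrite ya !inE eqxx.
  by rewrite /facet memE fsubD1set fsubsetD1 sca yc nay -eqSS -(card_fsetD1 ya) ca eqxx.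
- by move=> rho p q r cr /inS h1 /inS h2 /inS h3; apply: thin_in_simplex h1 h2 h3.
move=> sigma C _ HC p q fp fq; apply: HC => //.
have /and3P[pS /eqP cp _] := inS _ _ fp; have /and3P[qS /eqP cq _] := inS _ _ fq.
exact: card_setI_codim1 ca pS qS cp cq.
Qed.

Section Flip.
Variables (X Y : {fset {fset nat}}) (a b : {fset nat}).
Hypothesis (HX : sphere_like X) (Hf : flip d a b X Y).

Let S := a `|` b.

Let cS : #|` S| = d.+1.
Proof.
rewrite -(flip_card Hf) /S -cardfsUI.
by move: (flip_dis Hf); rewrite /fdisjoint => /eqP->; rewrite cardfs0 addn0.
Qed.

Let sl_down : down_closed X. Proof. by case: HX => -[]. Qed.

Let subS c : c `<=` S -> #|` c| = d -> exists2 y, y \in S & c = S `\ y.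
Proof. by move=> sc cc; apply: codim1_setD1; rewrite ?cc ?cS. Qed.

Let cSD y : y \in S -> #|` S `\ y| == d.
Proof. by move=> yS; rewrite -eqSS -(card_fsetD1 yS) cS. Qed.

Let a_nb : ~~ (b `<=` a).
Proof.
have /fset0Pn[y yb] := flip_b0 Hf; apply/fsubsetPn; exists y => //.
by rewrite (fdisjointFl (flip_dis Hf)).
Qed.

Let inXD y : y \in b -> S `\ y \in X.
Proof.
move=> yb; rewrite (flip_memX Hf) ?fsubD1set //; apply/fsubsetPn; exists y => //.
by rewrite !inE eqxx.
Qed.

Let inYD y : y \in a -> S `\ y \in Y.
Proof.
move=> ya; rewrite (flip_memY Hf) fsubD1set; apply/fsubsetPn; exists y => //.
by rewrite !inE eqxx.
Qed.

Let bS y : y \in b -> y \in S. Proof. by move=> yb; rewrite inE yb orbT. Qed.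
Let aS y : y \in a -> y \in S. Proof. by move=> yb; rewrite inE yb. Qed.

(* The only place where X must be a pseudomanifold with connected stars: without *)
(* this, Y would not be a complex.                                              *)
Lemma flip_star_a c : c \in X -> a `<=` c -> c `<=` S.
Proof.
move=> cX ac; have [q /and3P[qX /eqP cq scq]] := sl_pure HX cX.
apply: (fsubset_trans scq); have aX : a \in X by rewrite (flip_memX Hf) ?fsubsetUl.
have /fset0Pn[y0 y0b] := flip_b0 Hf.
have aSD y : y \in b -> a `<=` S `\ y.
  by move=> yb; rewrite fsubsetD1 fsubsetUl (fdisjointFl (flip_dis Hf)).
have aq : a `<=` q := fsubset_trans ac scq.
(* The star of [a] is explored from a facet inside [S]; it remains to see that crossing a ridge does
   not leave [S]. *)
apply: (@sl_conn X HX a (fun p => p `<=` S) aX _ (S `\ y0)); last 1 first.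
- exact: fsubD1set.
- move=> p r /and3P[pX /eqP cp ap] /and3P[rX /eqP cr ar] cpr pS.
  have [<-//|pr] := eqVneq p r.
  have [y yS py] := subS pS cp.
  have [z zp prz] := ridge_setD1 cp cr cpr pr.
  have yz : y != z by apply: contraTneq zp => <-; rewrite py !inE eqxx.
  have zS : z \in S by apply: (fsubsetP pS).
  have az : a `<=` p `\ z by rewrite -prz fsubsetI ap ar.
  have zb : z \in b.
    move: zS; rewrite inE => /orP[za|//].
    by move: (fsubsetP az _ za); rewrite !inE eqxx.
  (* The ridge lies in [p], [r] and [S] minus [z]; since [p] differs from both others, thinness
     identifies these. *)
  have /or3P[/eqP e|/eqP e|/eqP->] := @sl_thin X HX (p `\ z) p r (S `\ z)
    ltac:(by rewrite -(card_fsetD1 zp)) ltac:(by rewrite /facet pX cp eqxx fsubD1set)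
    ltac:(by rewrite /facet rX cr eqxx -prz fsubsetIr)
    ltac:(by rewrite /facet inXD // cSD // fsetSD).
  - by rewrite -e.
  - by move: zp; rewrite e !inE eqxx.
  - exact: fsubD1set.
- by rewrite /facet inXD // cSD ?bS // aSD.
- by rewrite /facet qX cq eqxx aq.
Qed.

(** [b] is not a face of [X], so every face of [Y] containing it was created inside the simplex. *)
Lemma flip_star_b c : c \in Y -> b `<=` c -> c `<=` S.
Proof.
rewrite (flip_memY Hf); case: ifP => // _ cX bc.
by have := sl_down cX bc; rewrite (flip_memX Hf) ?fsubsetUr // fsubset_refl.
Qed.

(** The danger is an old face outside the simplex that contains the deleted face [a]; [flip_star_a]
    excludes it. *)
Lemma flip_complex : is_complex Y.
Proof.
split; first by rewrite (flip_memY Hf) fsub0set fsubset0 (flip_a0 Hf).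
move=> c e; rewrite !(flip_memY Hf) -/S; case: ifP => cS' cY ec.
  rewrite (fsubset_trans ec cS'); apply: contra cY => /fsubset_trans; exact.
case: ifP => eS; last exact: sl_down cY ec.
apply: contraFN cS' => ae; apply: flip_star_a => //; exact: fsubset_trans ae ec.
Qed.

Lemma flip_pure : pure Y.
Proof.
move=> c cY; move: (cY); rewrite (flip_memY Hf) -/S; case: ifP => cS' H.
  have /fsubsetPn[y ya yc] := H; exists (S `\ y).
  by rewrite /facet inYD // cSD ?aS // fsubsetD1 cS' yc.
have [q /and3P[qX cq scq]] := sl_pure HX H; exists q.
rewrite /facet (flip_memY Hf) -/S; case: ifP => qS; last by rewrite qX cq scq.
by rewrite (fsubset_trans scq qS) in cS'.
Qed.

(** Ridges outside the simplex keep their facets, those containing [b] have all facets inside it,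
    and the remaining ones exchange one facet for another. *)
Lemma flip_thin : thin Y.
Proof.
move=> rho p q r cr fp fq fr.
have inX e : facet Y rho e -> e `<=` S = false -> facet X rho e.
  by rewrite /facet (flip_memY Hf) -/S => + eS; rewrite eS.
have outside e : ~~ (rho `<=` S) -> rho `<=` e -> e `<=` S = false.
  by move=> rS re; apply: contraNF rS; apply: fsubset_trans.
case/boolP: (rho `<=` S) => rS; last first.
  by apply: (sl_thin HX cr); apply: inX => //; apply: outside => //;
    [move: fp|move: fq|move: fr] => /and3P[].
have arho : ~~ (a `<=` rho).
  apply/negP => ar; have /and3P[pY _ rp] := fp.
  move: pY; rewrite (flip_memY Hf) -/S; have ap := fsubset_trans ar rp.
  by case: ifP => pS; rewrite ?ap // => /flip_star_a/(_ ap); rewrite -/S pS.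
case/boolP: (b `<=` rho) => br.
  have inS e : facet Y rho e -> [&& e `<=` S, #|` e| == d & rho `<=` e].
    by case/and3P => eY -> re; rewrite re flip_star_b // (fsubset_trans br re).
  by apply: (thin_in_simplex cS cr); apply: inS.
have /fsubsetPn[y ya yr] := arho; have /fsubsetPn[z zb zr] := br.
have yz : y != z by apply: contraTneq ya => ->; rewrite (fdisjointFl (flip_dis Hf) zb).
have rhoE : rho = S `\ z `\ y.
  apply/eqP; rewrite eqEfcard !fsubsetD1 rS yr zr /=.
  have := card_fsetD1 (bS zb); have := @card_fsetD1 (S `\ z) y.
  rewrite !inE yz ya => /(_ isT) e2 e1.
  by rewrite -2!ltnS -e2 -e1 cS cr.
have insideE e : facet Y rho e -> e `<=` S -> e = S `\ y.
  move=> /and3P[eY /eqP ce re] eS; have [x xS ex] := subS eS ce.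
  rewrite ex; congr (S `\ _); apply/eqP; apply: contraT => xy.
  move: re; rewrite rhoE ex fsubsetD1 !inE.
  move: (xS); rewrite inE xy => -> /=; rewrite andbT negbK.
  move=> /andP[_ /eqP xz]; move: eY; rewrite (flip_memY Hf) eS ex xz fsubsetD1 fsubsetUl.
  by rewrite (fdisjointFl (flip_dis Hf)).
(* Now [rho] is [S] without [y] and [z], and the only facet of [Y] over it inside [S] is [S] minus
   [y]. It replaces [S] minus [z]; [phi] undoes this exchange. *)
pose phi e := if e `<=` S then S `\ z else e.
have fphi e : facet Y rho e -> facet X rho (phi e).
  rewrite /phi; case: ifP => eS fe; last exact: inX.
  by rewrite /facet inXD // cSD ?bS // rhoE fsubD1set.
have phiI e f : facet Y rho e -> facet Y rho f -> phi e == phi f -> e == f.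
  move=> fe ff; rewrite /phi; case: ifP => eS; case: ifP => fS //.
  - by rewrite (insideE _ fe eS) (insideE _ ff fS).
  - by move=> /eqP e1; rewrite -e1 fsubD1set in fS.
  - by move=> /eqP e1; rewrite e1 fsubD1set in eS.
have := sl_thin HX cr (fphi _ fp) (fphi _ fq) (fphi _ fr).
by case/or3P => /phiI -> //; rewrite ?orbT.
Qed.

(** Facets of [Y] inside the simplex are pairwise adjacent. In the main case [C] is transported to
    [X] by treating all facets inside the simplex as one class. *)
Lemma flip_conn : star_connected Y.
Proof.
move=> sigma C sY HC.
have inX e : facet Y sigma e -> e `<=` S = false -> facet X sigma e.
  by rewrite /facet (flip_memY Hf) -/S => + eS; rewrite eS.
have inY e : facet X sigma e -> e `<=` S = false -> facet Y sigma e.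
  by rewrite /facet (flip_memY Hf) -/S => + eS; rewrite eS.
have Cin e f : facet Y sigma e -> facet Y sigma f -> e `<=` S -> f `<=` S -> C e -> C f.
  move=> fe ff eS fS; apply: HC => //.
  have /and3P[_ /eqP ce _] := fe; have /and3P[_ /eqP cf _] := ff.
  exact: card_setI_codim1 cS eS fS ce cf.
case/boolP: (sigma `<=` S) => sS; last first.
  have out e : sigma `<=` e -> e `<=` S = false.
    by move=> se; apply: contraNF sS; apply: fsubset_trans.
  have fXY e : facet Y sigma e = facet X sigma e.
    by rewrite /facet (flip_memY Hf) -/S; case se: (sigma `<=` e); rewrite ?andbF // out.
  have sX : sigma \in X by move: sY; rewrite (flip_memY Hf) (negPf sS).
  move=> p q fp fq; apply: (sl_conn HX sX (C := C)); rewrite -?fXY //.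
  by move=> e f; rewrite -!fXY; apply: HC.
case/boolP: (b `<=` sigma) => bs.
  move=> p q fp fq; apply: Cin => //; apply: flip_star_b.
  - by case/and3P: fp.
  - by case/and3P: fp => _ _ /(fsubset_trans bs).
  - by case/and3P: fq.
  - by case/and3P: fq => _ _ /(fsubset_trans bs).
have sX : sigma \in X by rewrite (flip_memX Hf).
have sa : ~~ (a `<=` sigma) by move: sY; rewrite (flip_memY Hf) sS.
have /fsubsetPn[y0 y0a y0s] := sa; have /fsubsetPn[z0 z0b z0s] := bs.
have fY0 : facet Y sigma (S `\ y0).
  by rewrite /facet inYD // cSD ?aS // fsubsetD1 sS.
have fX0 : facet X sigma (S `\ z0).
  by rewrite /facet inXD // cSD ?bS // fsubsetD1 sS.
pose C' : pred {fset nat} := fun e => if e `<=` S then C (S `\ y0) else C e.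
(* The ridge between [r] and [s] omits some [z] of [a], or else [flip_star_a] would put [s] inside
   [S]. The new facet [S] minus [z] contains this ridge and replaces [r]. *)
have bridge r s : facet X sigma r -> facet X sigma s -> r `<=` S -> s `<=` S = false ->
    (d <= #|` r `&` s|.+1)%N ->
    exists t, [/\ facet Y sigma t, t `<=` S & (d <= #|` t `&` s|.+1)%N].
  move=> /and3P[rX /eqP cr sr] /and3P[sX' /eqP cs ss] rS sS' crs.
  have rs : r != s by apply: contraFneq sS' => <-.
  have [z zr rsz] := ridge_setD1 cr cs crs rs.
  have [y yS ry] := subS rS cr.
  have yb : y \in b.
    move: yS; rewrite inE => /orP[ya|//].
    move: rX; rewrite (flip_memX Hf) // ry fsubsetD1 fsubsetUr.
    by rewrite (fdisjointFr (flip_dis Hf)).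
  have za : z \in a.
    apply: contraFT sS' => za; apply: flip_star_a => //.
    apply: (@fsubset_trans _ (r `&` s)); last exact: fsubsetIr.
    by rewrite rsz ry !fsubsetD1 fsubsetUl za (fdisjointFl (flip_dis Hf)).
  have sub : r `&` s `<=` (S `\ z) `&` s.
    by rewrite fsubsetI fsubsetIr rsz fsetSD.
  exists (S `\ z); split; last 2 first.
  - exact: fsubD1set.
  - by apply: leq_trans crs _; rewrite ltnS fsubset_leq_card.
  rewrite /facet inYD // cSD ?aS //.
  apply: fsubset_trans (fsubset_trans sub (fsubsetIl _ _)); by rewrite fsubsetI sr.
have C'step r s : facet X sigma r -> facet X sigma s -> (d <= #|` r `&` s|.+1)%N ->
    C' r -> C' s.
  move=> fr fs crs; rewrite /C'; case: ifP => rS; case: ifP => sS' //.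
  - move=> Cy; have [t [ft tS cts]] := bridge _ _ fr fs rS sS' crs.
    apply: (HC t s) => //; first exact: inY.
    by apply: Cin Cy => //; apply: fsubD1set.
  - move=> Cr; rewrite fsetIC in crs.
    have [t [ft tS cts]] := bridge _ _ fs fr sS' rS crs.
    apply: (Cin t) => //; first exact: fsubD1set.
    by apply: (HC r t) => //; [exact: inY|rewrite fsetIC].
  - by apply: HC => //; apply: inY.
pose hat e := if e `<=` S then S `\ z0 else e.
have fhat e : facet Y sigma e -> facet X sigma (hat e).
  by rewrite /hat => fe; case: ifP => // eS; apply: inX.
have Chat e : facet Y sigma e -> C' (hat e) = C e.
  move=> fe; rewrite /C' /hat; case eS: (e `<=` S); last by rewrite eS.
  by rewrite fsubD1set; apply/idP/idP; apply: Cin => //; apply: fsubD1set.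
move=> p q fp fq; rewrite -(Chat _ fp) -(Chat _ fq).
by apply: (sl_conn HX sX C'step); apply: fhat.
Qed.

Lemma flip_sphere_like : sphere_like Y.
Proof.
split; [exact: flip_complex|exact: flip_pure|exact: flip_thin|exact: flip_conn].
Qed.

End Flip.

Lemma sphere_like_dim X : sphere_like X -> complex_dim X = d%:Z - 1.
Proof.
move=> HX; apply/eqP; rewrite eq_le; apply/andP; split.
  rewrite /complex_dim big_seq; elim/big_ind: _ => [|u v|c cX].
  - lia.
  - by rewrite ge_max => -> ->.
  have [q /and3P[_ /eqP cq /fsubset_leq_card]] := sl_pure HX cX.
  by rewrite cq /face_dim; lia.
have [q /and3P[qX /eqP cq _]] := sl_pure HX (proj1 (sl_complex HX)).
have -> : d%:Z - 1 = face_dim q by rewrite /face_dim cq.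
rewrite /complex_dim; have : q \in enum_fset X := qX.
elim: (enum_fset X) => // c s IHs; rewrite inE big_cons le_max => /orP[/eqP<-|/IHs->].
  by rewrite lexx.
by rewrite orbT.
Qed.

Lemma bistellar_flip X Y a b : sphere_like X -> bistellar_move a b X Y -> flip d a b X Y.
Proof.
move=> HX [/andP[a0 b0] dab dim HI ->].
have memX c : c `<=` a `|` b -> (c \in X) = ~~ (b `<=` c).
  move=> cab; move/fsetP/(_ c): HI; rewrite mem_cjoin // cab /= => <-.
  by rewrite !inE cab andbT.
split=> //.
  by move: dim; rewrite (sphere_like_dim HX) /face_dim; lia.
move=> c; rewrite inE inE mem_cjoin // cjoinC mem_cjoin 1?fdisjoint_sym // (fsetUC b).
case: ifP => //= cab; last by rewrite orbF.
by rewrite memX // andNb.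
Qed.

End SphereLike.

Lemma stellated_sphere_like k d X : stellated k (d%:Z - 1) X -> sphere_like d X.
Proof.
elim=> [a ca|{}X Y a b _ IH _ HXY]; first by apply: sphere_like_boundary; lia.
exact: flip_sphere_like IH (bistellar_flip IH HXY).
Qed.

(** * The effect of a bistellar move *)

(** The coefficient of [x^j] in [x^s (1-x)^(N-s)], with [s] the size of [c]. The g-numbers of [M]
    have [N = d + 2], those of its links [N = d + 1]. *)
Definition g_term (N j : nat) (c : {fset nat}) : int :=
  if (#|` c| <= j)%N then (-1) ^+ (j + #|` c|) * 'C(N - #|` c|, j - #|` c|)%:Z else 0.

Definition g_num (N : nat) (X : {fset {fset nat}}) (j : nat) : int :=
  \sum_(c <- X) g_term N j c.

Lemma gvec_g_num d M j : gvec d M j = g_num (d + 2) M j.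
Proof.
rewrite /gvec /g_num; under eq_bigr do rewrite card_faces big_distrr /=.
rewrite exchange_big /=; apply: eq_bigr => c _; rewrite /g_term.
case: ifP => cj.
  rewrite (bigD1_seq #|` c|) ?mem_index_iota ?iota_uniq //= eqxx mulr1.
  rewrite big1 => [|s]; last by rewrite eq_sym => /negPf->; rewrite mulr0.
  by rewrite addr0 -signr_odd oddB // -oddD signr_odd.
rewrite big_nat big1 // => s /andP[_]; rewrite ltnS => sj.
case: eqP => [e|]; last by rewrite mulr0.
by rewrite -e cj in sj.
Qed.

(* Generating function: [x^b (1-x)^(N-b-a)], summed over an interval above b of rank a. *)
Lemma g_term_interval N j a b : fdisjoint a b -> (#|` a| + #|` b| <= N)%N ->
  \sum_(e <- fpowerset a) g_term N j (b `|` e) =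
  if (#|` b| <= j)%N then
    (-1) ^+ (j + #|` b|) * 'C(N - #|` b| - #|` a|, j - #|` b|)%:Z else 0.
Proof.
have [n] := ubnP #|` a|; elim: n a b => // n IHn a b; rewrite ltnS => an dab cN.
have [->|/fset0Pn[v va]] := eqVneq a fset0.
  by rewrite fpowerset0 big_seq_fset1 fsetU0 cardfs0 subn0.
have vb : v \notin b by rewrite (fdisjointFr dab).
have ca := card_fsetD1 va; rewrite -(fsetD1K va).
rewrite sum_fpowersetU1 ?big_split /=; last by rewrite !inE eqxx.
have va' : v \notin a `\ v by rewrite !inE eqxx.
have dab' : fdisjoint (a `\ v) b by apply: fdisjointWl dab; rewrite fsubD1set.
have cvb : #|` v |` b| = #|` b|.+1 by rewrite cardfsU1 vb.
rewrite fsetD1K // IHn //; [|lia|lia].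
under [X in _ + X]eq_bigr do rewrite fsetUCA fsetUA.
have dvb : fdisjoint (a `\ v) (v |` b) by rewrite fdisjointXU dab' andbT fdisjointX1.
rewrite IHn //; [|lia|lia].
rewrite cvb; move: cN; rewrite ca; move: #|` b| #|` a `\ v| => p q pq.
have [pj|pj|->] := ltngtP p j; last first.
- by rewrite addr0 subnn !bin0.
- by rewrite addr0.
rewrite addnS exprS mulN1r mulNr -mulrBr; congr (_ * _).
have -> : (N - p - q = (N - p.+1 - q).+1)%N by lia.
have -> : (N - p - q.+1 = N - p.+1 - q)%N by lia.
have -> : (j - p = (j - p.+1).+1)%N by lia.
by rewrite binS PoszD addrK.
Qed.

Lemma sum_interval (R : nmodType) (a b : {fset nat}) (h : {fset nat} -> R) : fdisjoint a b ->
  \sum_(c <- [fset c in fpowerset (a `|` b) | b `<=` c]) h c =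
  \sum_(e <- fpowerset a) h (b `|` e).
Proof.
move=> dab; pose f (e : {fset nat}) := b `|` e.
have fK : {in fpowerset a &, injective f}.
  move=> e1 e2; rewrite !fpowersetE => s1 s2 /(congr1 (fun c : {fset nat} => c `\` b)).
  have K e : e `<=` a -> f e `\` b = e.
    move=> ea; apply/fsetP => x; rewrite !inE; case xb: (x \in b) => //=.
    by apply/esym/negP => /(fsubsetP ea); rewrite (fdisjointFl dab xb).
  by rewrite !K.
have -> : [fset c in fpowerset (a `|` b) | b `<=` c] = [fset f e | e in fpowerset a].
  apply/fsetP => c; rewrite !inE fpowersetE; apply/andP/imfsetP => [[cab bc]|[e /=]].
    exists (c `\` b); first by rewrite /= fpowersetE fsubDset fsetUC.
    by apply/eqP; rewrite eqEfsubset fsubUset bc fsubsetDl /= -fsubDset fsubset_refl.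
  by rewrite fpowersetE => ea ->; rewrite fsubsetUl fsetUC fsetUSS.
by rewrite [LHS]big_imfset.
Qed.

Lemma in_fset_cond (K : choiceType) (A : {fset K}) (P : pred K) c :
  (c \in [fset x in A | P x]) = (c \in A) && P c.
Proof. by rewrite !inE. Qed.

(** Adding to [Y] the faces of the simplex that contain [a], or to [X] those that contain [b], gives
    the same family [T]. *)
Lemma flip_sum (R : zmodType) d a b X Y (h : {fset nat} -> R) : flip d a b X Y ->
  \sum_(c <- Y) h c = \sum_(c <- X) h c
    + \sum_(e <- fpowerset a) h (b `|` e) - \sum_(e <- fpowerset b) h (a `|` e).
Proof.
move=> Hf; apply/eqP; rewrite -subr_eq opprK; apply/eqP.
have dab := flip_dis Hf.
have dba : fdisjoint b a by rewrite fdisjoint_sym.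
rewrite -(sum_interval h dab) -(sum_interval h dba) (fsetUC b a).
pose T := X `|` fpowerset (a `|` b).
have memT c : (c \in T) = if c `<=` a `|` b then true else c \in X.
  by rewrite inE fpowersetE; case: ifP; rewrite ?orbT ?orbF.
transitivity (\sum_(c <- T) h c).
  rewrite [RHS](big_fsetID _ (mem Y)) /=; congr (_ + _); congr bigop; congr enum_fset;
    apply/fsetP => c; rewrite !in_fset_cond memT ?fpowersetE /= (flip_memY Hf).
    by case: ifP => _; rewrite ?andbb.
  by case: ifP => _; rewrite ?negbK // andbN.
rewrite (big_fsetID _ (mem X)) /=; congr (_ + _); congr bigop; congr enum_fset;
  apply/fsetP => c; rewrite !in_fset_cond memT ?fpowersetE /=.
  by case: ifP; rewrite ?andbb.
by case: ifP => cab; rewrite ?andbN // (flip_memX Hf) ?negbK.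
Qed.

(** Since [#a + #b = d + 1], no factor [1 - x] is left in the two interval sums, which are [x^#b]
    and [x^#a]. *)
Lemma g_num_flip d a b X Y j : flip d a b X Y ->
  g_num d.+1 Y j = g_num d.+1 X j + (j == #|` b|)%:R - (j == #|` a|)%:R.
Proof.
move=> Hf; rewrite /g_num (flip_sum _ Hf).
have dab := flip_dis Hf; have cab := flip_card Hf.
have E e f : fdisjoint e f -> (#|` e| + #|` f| = d.+1)%N ->
    \sum_(c <- fpowerset e) g_term d.+1 j (f `|` c) = (j == #|` f|)%:R.
  move=> def cef; rewrite g_term_interval // ?cef //.
  have -> : (d.+1 - #|` f| - #|` e| = 0)%N by rewrite -cef; lia.
  have [fj|fj|->] := ltngtP #|` f| j.
  - by rewrite bin_small ?mulr0 ?subn_gt0.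
  - by [].
  - by rewrite subnn bin0 mulr1 addnn -signr_odd odd_double.
by rewrite !E // 1?fdisjoint_sym // addnC.
Qed.

Lemma g_num_boundary d a j : #|` a| = d.+1 -> (j <= d)%N ->
  g_num d.+1 (simplex_boundary a) j = (j == 0%N)%:R.
Proof.
move=> ca jd; have aa : a \in fpowerset a by rewrite fpowersetE.
have := @g_term_interval d.+1 j a fset0 (fdisjointX0 _).
rewrite cardfs0 addn0 ca leqnn => /(_ isT).
under eq_bigr do rewrite fset0U.
rewrite (big_fsetD1 _ aa) /= {1}/g_term ca ltnNge jd add0r.
rewrite -/(simplex_boundary a) -/(g_num _ _ _) => ->.
rewrite !subn0 subnn addn0; case: j jd => [|j] _; first by rewrite bin0.
by rewrite bin_small // mulr0.
Qed.

(** A move affects only the degrees [#b <= k] and [#a >= d + 1 - k], and [j] lies strictly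
    between. *)
Lemma stellated_g_num_eq0 k d X j : stellated k (d%:Z - 1) X -> (k < j)%N -> (j + k <= d)%N ->
  g_num d.+1 X j = 0.
Proof.
move=> HX kj jkd; elim: HX => [a ca|{}X Y a b HX IH bk HXY].
  by rewrite g_num_boundary; [case: j kj jkd|lia|lia].
have Hf := bistellar_flip (stellated_sphere_like HX) HXY.
have := flip_card Hf; rewrite (g_num_flip _ Hf) IH // => cab.
have cb : (#|` b| <= k)%N by move: bk; rewrite /face_dim; lia.
have -> : (j == #|` b|) = false by lia.
by have -> : (j == #|` a|) = false by lia.
Qed.

(** * Induced subcomplexes under bistellar moves *)

Definition restrict (X : {fset {fset nat}}) (A : {fset nat}) : {fset {fset nat}} :=
  [fset c in X | c `<=` A].

Lemma in_restrict X A c : (c \in restrict X A) = (c \in X) && (c `<=` A).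
Proof. by rewrite !inE. Qed.

Lemma restrict_closed X A : down_closed X -> down_closed (restrict X A).
Proof.
move=> HX c e; rewrite !in_restrict => /andP[cX cA] ec.
by rewrite (HX _ _ cX ec) (fsubset_trans ec).
Qed.

Section StellatedBound.
Variable F : fieldType.

Lemma alt_betti_void l : alt_betti F l fset0 = 0.
Proof.
rewrite /alt_betti /alt_card big_mkcond big_seq_fset0 sub0r; apply/eqP.
rewrite oppr_eq0 eqz_nat -leqn0 (leq_trans (rank_leq_row _)) //.
rewrite leqn0 -cardfE cardfs_eq0; apply/eqP/fsetP => c; by rewrite in_faces inE.
Qed.

Lemma alt_betti_cone l v X : down_closed X -> (forall c, c \in X -> v |` c \in X) ->
  alt_betti F l X = 0.
Proof.
move=> HX Hv; rewrite (@alt_betti_expand F l v fset0 X) ?alt_betti_void ?fsub0set //.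
by move=> c cX _; rewrite Hv //= inE.
Qed.

Lemma alt_betti_empty_face l : alt_betti F l [fset fset0] = (-1) ^+ l.
Proof.
rewrite /alt_betti /alt_card big_mkcond big_seq_fset1 cardfs0 addn0 /=.
have -> : bd_rank F l [fset fset0] = 0%N; last by rewrite subr0.
apply/eqP; rewrite -leqn0 (leq_trans (rank_leq_row _)) //.
rewrite leqn0 -cardfE cardfs_eq0; apply/eqP/fsetP => c; rewrite in_faces !inE.
by apply/andP => -[/eqP->]; rewrite cardfs0.
Qed.

(** Both complexes are compared with [T], the union of [X] and the full simplex. A vertex of [A] in
    [a] gives an expansion from [X] to [T], one in [b] an expansion from [Y] to [T]; without such a
    vertex at most one face is added. *)
Lemma flip_alt_betti_le d a b X Y l A : sphere_like d X -> flip d a b X Y ->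
    (l.+1 < #|` a|)%N ->
  alt_betti F l (restrict Y A) <= alt_betti F l (restrict X A)
    + (if A `&` (a `|` b) == b then
         if (#|` b| <= l)%N then (-1) ^+ (l + #|` b|) else 0 else 0).
Proof.
move=> HX Hf la; set S := a `|` b.
have dX : down_closed X by case: (sl_complex HX).
have dY : down_closed Y by case: (flip_complex HX Hf).
have dab := flip_dis Hf.
pose T := X `|` fpowerset S.
have memT c : (c \in T) = if c `<=` S then true else c \in X.
  by rewrite inE fpowersetE; case: ifP; rewrite ?orbT ?orbF.
have dT : down_closed T.
  move=> c e; rewrite !inE !fpowersetE => /orP[cX|cS] ec.
    by rewrite (dX _ _ cX ec).
  by rewrite (fsubset_trans ec cS) orbT.
have dTA := restrict_closed (A := A) dT.
have dXA := restrict_closed (A := A) dX; have dYA := restrict_closed (A := A) dY.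
have memX c : (c \in X) = if c `<=` S then ~~ (b `<=` c) else c \in X.
  by case: ifP => // cS; rewrite (flip_memX Hf).
have memY := flip_memY Hf.
have exX v : v \in a -> v \in A -> alt_betti F l (restrict T A) = alt_betti F l (restrict X A).
  move=> va vA; apply: (@alt_betti_expand F l v) => //.
    apply/fsubsetP => c; rewrite !in_restrict memT memX.
    by case: (c `<=` S) => // /andP[].
  move=> c; rewrite !in_restrict memT memX; case cS: (c `<=` S); last by move=> /andP[-> ->].
  move=> /= cA; rewrite cA andbT negbK => bc; rewrite memT (memX (c `\ v)).
  rewrite !fsubUset !fsub1set vA cA cS inE va /= (fsubset_trans (fsubD1set _ _) cS).
  by rewrite negb_and negbK fsubsetD1 bc (fdisjointFr dab va).
have exY v : v \in b -> v \in A -> alt_betti F l (restrict T A) = alt_betti F l (restrict Y A).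
  move=> vb vA; apply: (@alt_betti_expand F l v) => //.
    apply/fsubsetP => c; rewrite !in_restrict memT memY.
    by case: (c `<=` S) => // /andP[].
  move=> c; rewrite !in_restrict memT memY; case cS: (c `<=` S); last by move=> /andP[-> ->].
  move=> /= cA; rewrite cA andbT negbK => bc; rewrite memT (memY (c `\ v)).
  rewrite !fsubUset !fsub1set vA cA cS inE vb orbT /= (fsubset_trans (fsubD1set _ _) cS).
  by rewrite negb_and negbK fsubsetD1 bc (fdisjointFl dab vb).
have eqT Z e : (forall c, (c \in Z) = if c `<=` S then ~~ (e `<=` c) else c \in X) ->
    ~~ (e `<=` A) -> restrict T A = restrict Z A.
  move=> memZ eA; apply/fsetP => c; rewrite !in_restrict memT memZ.
  case cA: (c `<=` A); rewrite ?andbF ?andbT //; case: (c `<=` S) => //.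
  by apply/esym; apply: contra eA => /fsubset_trans; apply.
have addT Z e f : (forall c, (c \in Z) = if c `<=` S then ~~ (e `<=` c) else c \in X) ->
    S = e `|` f -> e `<=` A -> (forall v, v \in f -> v \notin A) ->
    restrict T A = e |` restrict Z A /\ e \notin restrict Z A.
  move=> memZ eS eA fA; split; last by rewrite in_restrict memZ eS fsubsetUl fsubset_refl.
  apply/fsetP => c; rewrite in_fset1U !in_restrict memT memZ.
  have [->|ce] /= := eqVneq c e; first by rewrite eS fsubsetUl eA.
  case cA: (c `<=` A); rewrite ?andbF ?andbT //; case cS: (c `<=` S) => //.
  apply/esym; apply: contra ce => ec; rewrite eqEfsubset ec andbT.
  apply/fsubsetP => x xc; have := fsubsetP cS _ xc; rewrite eS inE => /orP[//|/fA].
  by rewrite (fsubsetP cA _ xc).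
(* If [A] contains [a] and avoids [b], only [a] is added, and it has too many vertices to change the
   value. *)
have upper : alt_betti F l (restrict Y A) <= alt_betti F l (restrict T A).
  case: (boolP (a `<=` A)) => aA; last by rewrite (eqT _ _ memY aA).
  case: (boolP [exists v : b, val v \in A]) => [/existsP[v vA]|/existsPn nb].
    by rewrite (exY _ (fsvalP v) vA).
  have [|eT nY] := addT Y a b memY (erefl _) aA; first by move=> v vb; exact: (nb [`vb]).
  have dT' : down_closed (a |` restrict Y A) by rewrite -eT.
  by rewrite eT (proj2 (alt_betti_add_face F l dYA dT' nY)).
apply: le_trans upper _.
case: (boolP [exists v : a, val v \in A]) => [/existsP[v vA]|/existsPn na].
  rewrite (exX _ (fsvalP v) vA) ifF ?addr0 //; apply/eqP => e.
  have : val v \in A `&` S by rewrite !inE vA fsvalP.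
  by rewrite e (fdisjointFr dab (fsvalP v)).
case: (boolP (b `<=` A)) => bA; last first.
  rewrite (eqT _ _ memX bA) ifF ?addr0 //; apply: contraNF bA => /eqP <-.
  exact: fsubsetIl.
have -> : A `&` S == b.
  rewrite eqEfsubset fsubsetI bA fsubsetUr !andbT; apply/fsubsetP => x.
  rewrite !inE => /andP[xA /orP[xa|//]]; by have := na [`xa]; rewrite /= xA.
have [|eT nX] := addT X b a memX (fsetUC _ _) bA; first by move=> v va; exact: (na [`va]).
have dT' : down_closed (b |` restrict X A) by rewrite -eT.
by rewrite eT (proj1 (alt_betti_add_face F l dXA dT' nX)).
Qed.

End StellatedBound.

(** * From links to the manifold *)

(** Induction on the moves: each one adds at most its term of degree [#b]. [W0] collects the
    vertices of the initial sphere and of all moves, so that each trace has its full Beta weight. *)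
Lemma stellated_beta_avg_le (F : fieldType) k d l X : stellated k (d%:Z - 1) X -> (l + k < d)%N ->
  exists W0 : {fset nat}, forall W : {fset nat}, W0 `<=` W ->
    beta_avg W (fun A => (alt_betti F l (restrict X A))%:~R) <=
    \sum_(0 <= i < l.+1) (-1) ^+ (l + i) * beta_weight d.+1 i * (g_num d.+1 X i)%:~R.
Proof.
move=> HX lkd; elim: HX => [a ca'|{}X Y a b HX [W0 IH] bk HXY].
  have ca : #|` a| = d.+1 by lia.
  exists a => W aW; rewrite big_nat_recl // big_nat big1 => [|i /andP[_ il]]; last first.
    by rewrite g_num_boundary // ?mulr0 //; lia.
  rewrite g_num_boundary // addn0 addr0 /= mulr1 mulrC -(cardfs0 nat) -ca.
  (* For the initial sphere only sets [A] disjoint from [a] contribute: otherwise the restriction is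
     a cone, or the whole sphere, whose homology lies above the degrees counted. *)
  rewrite -(beta_avg_trace _ (fsub0set a) aW); apply: ler_beta_avg => A AW.
  have [Aa0|/fset0Pn[v]] := eqVneq (A `&` a) fset0.
    have -> : restrict (simplex_boundary a) A = [fset fset0]; last first.
      by rewrite alt_betti_empty_face rmorphXn rmorphN1.
    apply/fsetP => c; rewrite in_restrict !inE fpowersetE -fsubset0 -Aa0 fsubsetI.
    case cA: (c `<=` A); rewrite ?andbF ?andbT //=; case: eqP => //= e.
    apply/esym/negP => caa; have : c `<=` A `&` a by rewrite fsubsetI cA.
    by rewrite Aa0 fsubset0 e -cardfs_eq0 ca.
  rewrite inE => /andP[vA va].
  have cone U : v \in U -> alt_betti F l (fpowerset U) = 0.
    move=> vU; apply: (@alt_betti_cone F l v); first exact: fpowerset_closed.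
    by move=> c; rewrite !fpowersetE fsubUset fsub1set vU.
  case: (boolP (a `<=` A)) => aA; last first.
    have -> : restrict (simplex_boundary a) A = fpowerset (A `&` a).
      apply/fsetP => c; rewrite in_restrict !inE !fpowersetE fsubsetI.
      rewrite andbC; case cA: (c `<=` A) => //=; case: eqP => // e.
      by rewrite -e cA in aA.
    by rewrite cone // inE vA.
  have -> : restrict (simplex_boundary a) A = simplex_boundary a.
    apply/fsetP => c; rewrite in_restrict !inE !fpowersetE.
    case cA: (c `<=` a); rewrite ?andbF ?andbT //=.
    by rewrite (fsubset_trans cA aA) andbT.
  have dsl := sl_complex (sphere_like_boundary ca).
  have E : a |` simplex_boundary a = fpowerset a.
    by rewrite fsetD1K // fpowersetE.
  have := alt_betti_add_face F l (proj2 dsl) (c := a).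
  rewrite E => /(_ (@fpowerset_closed a)) [|_ <-].
  - by rewrite !inE eqxx.
  - by rewrite cone.
  - by rewrite ca; lia.
have HS := stellated_sphere_like HX; have Hf := bistellar_flip HS HXY.
have cab := flip_card Hf.
have cb : (#|` b| <= k)%N by move: bk; rewrite /face_dim; lia.
have la : (l.+1 < #|` a|)%N by lia.
exists (W0 `|` (a `|` b)) => W; rewrite fsubUset => /andP[W0W abW].
set T := if (#|` b| <= l)%N then (-1) ^+ (l + #|` b|) else 0 : rat.
have caU : #|` a `|` b| = d.+1.
  rewrite -cab -cardfsUI.
  by move: (flip_dis Hf); rewrite /fdisjoint => /eqP->; rewrite cardfs0 addn0.
apply: (@le_trans _ _ (beta_avg W (fun A => (alt_betti F l (restrict X A))%:~R
    + (if A `&` (a `|` b) == b then T else 0)))).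
  apply: ler_beta_avg => A _.
  have := flip_alt_betti_le F A HS Hf la; rewrite -(ler_int rat) intrD.
  move=> H; apply: le_trans H _; rewrite lerD2l.
  by rewrite /T; case: ifP => // _; case: ifP => // _; rewrite rmorphXn rmorphN1.
rewrite beta_avgD beta_avg_trace ?fsubsetUr // caU.
apply: le_trans (lerD (IH W W0W) (lexx _)) _.
have gE i : (0 <= i < l.+1)%N ->
    (-1) ^+ (l + i) * beta_weight d.+1 i * (g_num d.+1 Y i)%:~R =
    (-1) ^+ (l + i) * beta_weight d.+1 i * (g_num d.+1 X i)%:~R +
    (if i == #|` b| then beta_weight d.+1 #|` b| * T else 0) :> rat.
  move=> /andP[_ il]; rewrite (g_num_flip _ Hf).
  (* The loss in degree [#a] falls outside the sum, as [#a > l + 1]. *)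
  have -> : (i == #|` a|) = false by lia.
  rewrite subr0 rmorphD /= mulrDr; congr (_ + _).
  case: eqP => [e|]; last by rewrite mulr0.
  by rewrite /T -e -ltnS il mulr1 mulrC.
rewrite (eq_big_nat _ _ gE) big_split /= lerD2l.
have [bl|bl] := leqP #|` b| l.
  rewrite (bigD1_seq #|` b|) ?mem_index_iota ?ltnS ?bl ?iota_uniq //= eqxx.
  by rewrite big1 ?addr0 // => i /negPf->.
have T0 : T = 0 by rewrite /T leqNgt bl.
by rewrite T0 mulr0; apply: sumr_ge0 => i _; case: ifP.
Qed.

(** With [P = x^s (1-x)^(N-s)], this is the coefficient of [x^i] in [s P / x = N P + (1-x) P']. *)
Lemma g_term_link N i c :
  g_term N i.+1 c *+ #|` c| = g_term N i c *+ (N - i) + g_term N i.+1 c *+ i.+1.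
Proof.
rewrite /g_term; move: #|` c| => s; have [si|si|->] := ltngtP s i.+1.
- have si' : (s <= i)%N by rewrite -ltnS.
  rewrite si' addSn exprS mulN1r subSn //.
  have := mul_bin_left (N - s) (i - s).
  have -> : (N - s - (i - s) = N - i)%N by lia.
  move=> /(congr1 (fun n => n%:Z)); rewrite !PoszM => key.
  rewrite -[LHS]mulr_natr -[X in _ = X + _]mulr_natr -[X in _ = _ + X]mulr_natr !natz.
  rewrite (_ : i.+1%:Z = s%:Z + (i - s).+1%:Z); last by lia.
  by rewrite -[X in _ = X + _]mulrA [X in _ = _ * X + _]mulrC -key; ring.
- by rewrite leqNgt (ltn_trans _ si) // !mul0rn addr0.
- by rewrite ltnn mul0rn add0r.
Qed.

Section Manifold.
Variables (F : fieldType) (M : {fset {fset nat}}).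
Hypothesis HM : is_complex M.

Let V := vertices M.
Let dM : down_closed M. Proof. by case: HM. Qed.

Lemma face_sub_vertices c : c \in M -> c `<=` V.
Proof.
move=> cM; apply/fsubsetP => x xc; apply/bigfcupP; exists c => //.
by rewrite cM.
Qed.

Lemma vertices_face x : x \in V -> [fset x] \in M.
Proof.
move=> /bigfcupP[c /andP[cM _] xc]; apply: dM cM _.
by rewrite fsub1set.
Qed.

Lemma g_num_links N i :
  \sum_(x <- V) g_num N (link x M) i =
  g_num N.+1 M i *+ (N.+1 - i) + g_num N.+1 M i.+1 *+ i.+1.
Proof.
transitivity (\sum_(x <- V) \sum_(c <- link x M) g_term N.+1 i.+1 (x |` c)).
  apply: eq_bigr => x _; apply: eq_big_seq => c; rewrite in_link => /and3P[_ xc _].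
  rewrite /g_term cardfsU1 xc add1n ltnS !subSS.
  by rewrite addSn addnS !exprS !mulN1r opprK.
rewrite double_count_link //; last exact: face_sub_vertices.
rewrite /g_num -!sumrMnl -big_split /=; apply: eq_bigr => c _.
exact: g_term_link.
Qed.

Lemma g_num0 N : g_num N M 0 = 1.
Proof.
have M0 : fset0 \in M by case: HM.
rewrite /g_num (big_fsetD1 _ M0) /= {1}/g_term cardfs0 addn0 subn0 bin0 mulr1.
rewrite big_seq big1 ?addr0 // => c; rewrite !inE => /andP[c0 _].
by rewrite /g_term leqn0 cardfs_eq0 (negPf c0).
Qed.

(** [beta_avg_telescope] is applied to [alt_betti] of the induced subcomplexes, whose increments
    [alt_betti_link] bounds. The sign is the value at the empty set. *)
Lemma alt_betti_le_links l :
  (alt_betti F l.+1 M)%:~R + (-1) ^+ l <=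
  \sum_(x <- V) beta_avg (V `\ x) (fun A => (alt_betti F l (restrict (link x M) A))%:~R).
Proof.
pose phi A : rat := (alt_betti F l.+1 (restrict M A))%:~R.
have -> : (alt_betti F l.+1 M)%:~R + (-1) ^+ l = phi V - phi fset0.
  rewrite /phi; have -> : restrict M V = M.
    apply/fsetP => c; rewrite in_restrict.
    by case cM: (c \in M) => //=; apply: face_sub_vertices.
  have -> : restrict M fset0 = [fset fset0].
    apply/fsetP => c; rewrite in_restrict fsubset0 !inE.
    by case: eqP => [->|]; rewrite ?andbF ?andbT //; case: HM.
  by rewrite alt_betti_empty_face rmorphXn rmorphN1 exprS mulN1r opprK.
rewrite -beta_avg_telescope big_seq [leRHS]big_seq; apply: ler_sum => x xV.
apply: ler_beta_avg => A; rewrite fsubsetD1 => /andP[AV xA].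
rewrite /phi lerBlDl -rmorphD ler_int.
have dR := restrict_closed (A := x |` A) dM.
apply: le_trans (alt_betti_link F l x dR) _.
rewrite le_eqVlt; apply/orP; left; apply/eqP; congr (alt_betti F _ _ + alt_betti F _ _).
  apply/fsetP => c; rewrite in_fset_cond !in_restrict -andbA.
  case: (c \in M) => //=; have [xc|xc] := boolP (x \in c); rewrite ?andbF ?andbT.
    by apply/esym/negP => /fsubsetP/(_ x xc); rewrite (negPf xA).
  rewrite -[c in LHS](mem_fsetD1 xc) fsubDset fsetUA fsetUid -fsubDset.
  by rewrite mem_fsetD1.
apply/fsetP => c; rewrite in_link !in_restrict in_link.
case: (c \in M) => //=; have [xc|xc] /= := boolP (x \in c); first by rewrite andbF.
rewrite fsubUset fsub1set fset1U1 /=.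
case: (x |` c \in M); rewrite ?andbF //= andbb.
by rewrite -fsubDset mem_fsetD1.
Qed.

Lemma beta_weight_binl d i : (i <= d.+1)%N ->
  beta_weight d.+1 i *+ (d.+2 - i) = 'C(d + 2, i)%:R^-1.
Proof.
move=> id; rewrite /beta_weight -[LHS]mulr_natr mulrAC -natrM addn2.
have := bin_fact (leq_trans id (leqnSn _)); rewrite subSn // factS => <-.
rewrite (_ : (_ * _ * _)%N = i`! * ((d.+1 - i).+1 * (d.+1 - i)`!))%N; last by lia.
set m := (i`! * _)%N; rewrite natrM invfM mulrCA divff ?mulr1 //.
by rewrite pnatr_eq0 -lt0n !muln_gt0 !fact_gt0.
Qed.

Lemma beta_weight_binr d i : (i <= d.+1)%N ->
  beta_weight d.+1 i *+ i.+1 = 'C(d + 2, i.+1)%:R^-1.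
Proof.
move=> id; rewrite /beta_weight -[LHS]mulr_natr mulrAC -natrM addn2.
have := @bin_fact d.+2 i.+1 id; rewrite subSS factS => <-.
rewrite (_ : (_ * _ * _)%N = i.+1 * i`! * (d.+1 - i)`!)%N; last by lia.
set m := (i.+1 * _ * _)%N; rewrite natrM invfM mulrCA divff ?mulr1 //.
by rewrite pnatr_eq0 -lt0n !muln_gt0 !fact_gt0.
Qed.

(** The Beta weight turns both coefficients of [g_num_links] into inverse binomials, which gives the
    telescoping form [q_i + q_(i+1)]. *)
Lemma g_num_links_weight d i : (i <= d.+1)%N ->
  beta_weight d.+1 i * (\sum_(x <- V) g_num d.+1 (link x M) i)%:~R =
  (gvec d M i)%:~R / 'C(d + 2, i)%:R + (gvec d M i.+1)%:~R / 'C(d + 2, i.+1)%:R :> rat.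
Proof.
move=> id; rewrite g_num_links -beta_weight_binl // -beta_weight_binr //.
rewrite !gvec_g_num addn2 rmorphD !rmorphMn /= mulrDr.
by rewrite !mulrnAr ![_ * beta_weight _ _]mulrC.
Qed.

(** Only the two ends of the alternating sum remain; [q_0 = 1] gives the sign. *)
Lemma g_num_links_telescope d l : (l <= d.+1)%N ->
  \sum_(0 <= i < l.+1) (-1) ^+ (l + i) * beta_weight d.+1 i
     * (\sum_(x <- V) g_num d.+1 (link x M) i)%:~R =
  (gvec d M l.+1)%:~R / 'C(d + 2, l.+1)%:R + (-1) ^+ l :> rat.
Proof.
elim: l => [|l IHl] ld.
  rewrite big_nat1 addn0 expr0 mul1r g_num_links_weight // bin0 divr1.
  by rewrite {1}gvec_g_num g_num0 addrC.
rewrite big_nat_recr //= addnn -signr_odd odd_double expr0 mul1r g_num_links_weight //.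
have -> : \sum_(0 <= i < l.+1) (-1) ^+ (l.+1 + i) * beta_weight d.+1 i
     * (\sum_(x <- V) g_num d.+1 (link x M) i)%:~R =
    - ((gvec d M l.+1)%:~R / 'C(d + 2, l.+1)%:R + (-1) ^+ l) :> rat.
  rewrite -IHl ?(ltnW ld) // -sumrN; apply: eq_bigr => i _.
  by rewrite addSn exprS mulN1r !mulNr.
rewrite exprS mulN1r; ring.
Qed.

Lemma alt_betti_le_gvec k d l : (l + k < d)%N ->
    (forall x, x \in V -> stellated k (d%:Z - 1) (link x M)) ->
  (alt_betti F l.+1 M)%:~R <= (gvec d M l.+1)%:~R / 'C(d + 2, l.+1)%:R :> rat.
Proof.
move=> lkd HL; rewrite -(lerD2r ((-1) ^+ l)) -g_num_links_telescope; last by lia.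
apply: le_trans (alt_betti_le_links l) _.
under [leRHS]eq_bigr do rewrite rmorph_sum /= big_distrr /=.
rewrite exchange_big /= big_seq [leRHS]big_seq; apply: ler_sum => x xV.
have [W0 HW] := stellated_beta_avg_le F (HL x xV) lkd.
(* The ground set may be enlarged to contain [W0], since faces of the link of [x] use only vertices
   of [V] other than [x]. *)
rewrite -(@beta_avg_indep (V `\ x) (W0 `|` V `\ x)) ?fsubsetUr //; last first.
  move=> A _; congr (_%:~R); congr alt_betti; apply/fsetP => c.
  rewrite !in_restrict in_link fsubsetI fsubsetD1.
  case cM: (c \in M) => //=; case: (x \notin c) => //=; rewrite ?andbT.
  by rewrite face_sub_vertices // andbT.
by apply: HW; exact: fsubsetUl.
Qed.

Lemma gvec_consecutive k d i : (k < i)%N -> (i + k <= d)%N ->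
    (forall x, x \in V -> stellated k (d%:Z - 1) (link x M)) ->
  (gvec d M i)%:~R / 'C(d + 2, i)%:R + (gvec d M i.+1)%:~R / 'C(d + 2, i.+1)%:R = 0 :> rat.
Proof.
move=> ki ikd HL; rewrite -g_num_links_weight; last by lia.
rewrite big_seq big1 ?mulr0 // => x xV; exact: stellated_g_num_eq0 (HL x xV) ki ikd.
Qed.

(** [K] consists of the vertices and the edges at [x0]; 2-neighbourliness makes it a cone. For
    [l <= 1] it has the same count as [M] and no larger rank, so [alt_betti F l M <= 0]; the general
    lower bounds then force equality. *)
Lemma alt_betti1_eq0 x0 : two_neighbourly M -> x0 \in V -> alt_betti F 1 M = 0.
Proof.
move=> H2 x0V; pose K := [fset c in M | (#|` c `\ x0| <= 1)%N].
have dK : down_closed K.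
  move=> c e; rewrite !in_fset_cond => /andP[cM c1] ec; rewrite (dM cM ec) /=.
  by apply: leq_trans c1; rewrite fsubset_leq_card // fsetSD.
have coneK c : c \in K -> x0 |` c \in K.
  rewrite !in_fset_cond => /andP[cM c1].
  have -> : (x0 |` c) `\ x0 = c `\ x0.
    by apply/fsetP => z; rewrite !inE; case: (eqVneq z x0).
  rewrite c1 andbT; have -> : x0 |` c = x0 |` (c `\ x0).
    by apply/fsetP => z; rewrite !inE; case: (eqVneq z x0).
  have [->|/fset0Pn[y yc]] := eqVneq (c `\ x0) fset0.
    by rewrite fsetU0 vertices_face.
  have cE : c `\ x0 = [fset y].
    by apply/eqP; rewrite eq_sym eqEfcard fsub1set yc cardfs1.
  move: yc; rewrite cE !inE => _; apply: H2 => //.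
    apply: (fsubsetP (face_sub_vertices cM)).
    by have := fset11 y; rewrite -cE inE => /andP[].
  by have := fset11 y; rewrite -cE !inE eq_sym => /andP[].
have KM : K `<=` M by apply/fsubsetP => c; rewrite in_fset_cond => /andP[].
have le0 l : (l <= 1)%N -> alt_betti F l M <= 0.
  move=> l1; rewrite -(alt_betti_cone F l dK coneK) /alt_betti.
  have -> : alt_card l K = alt_card l M.
    rewrite /alt_card big_fset_condE [RHS]big_fset_condE.
    congr bigop; congr enum_fset; apply/fsetP => c; rewrite !in_fset_cond.
    case cl: (#|` c| <= l)%N; rewrite ?andbF // (leq_trans _ (leq_trans cl l1)) ?andbT //.
    by rewrite fsubset_leq_card // fsubD1set.
  rewrite lerD2l lerN2 lez_nat (bd_rankE F (O := M) _ dK) // (bd_rankE F (O := M) _ dM) //.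
  apply: chain_rank_mono; apply/fsubsetP => c; rewrite !in_faces => /andP[cK ->].
  by rewrite (fsubsetP KM).
have h0 := alt_betti0_ge0 F M; have h1 := alt_betti_recr_ge0 F 0 dM.
by have := le0 0%N isT; have := le0 1%N isT; lia.
Qed.

End Manifold.

Lemma vertices_neq0 d M : complex_dim M = d%:Z -> exists x, x \in vertices M.
Proof.
move=> dimM; have [V0|/fset0Pn//] := eqVneq (vertices M) fset0.
suff : complex_dim M <= -1 by rewrite dimM; lia.
rewrite /complex_dim big_seq; elim/big_ind: _ => // [u v|c cM].
  by rewrite ge_max => -> ->.
by have := face_sub_vertices cM; rewrite V0 fsubset0 => /eqP->; rewrite /face_dim cardfs0.
Qed.

Theorem proposition5p5 (F : fieldType) (k d : nat) (M : {fset {fset nat}})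
    (M_in_W : in_W k d M) (M_2nbly : two_neighbourly M) :
  [/\ (* (a) *)
      d = (2 * k)%N ->
      forall l : nat, (1 <= l)%N -> (l < k)%N ->
        gvec d M l.+1 >=
          'C(d + 2, l.+1)%:Z *
          \sum_(1 <= i < l.+1) (-1) ^+ (l - i) * (betti F M i)%:Z,
      (* (b) *)
      (2 * k + 1 <= d)%N ->
      forall l : nat, (1 <= l)%N -> (l <= k)%N ->
        gvec d M l.+1 >=
          'C(d + 2, l.+1)%:Z *
          \sum_(1 <= i < l.+1) (-1) ^+ (l - i) * (betti F M i)%:Z,
      (* (c) *)
      (2 * k + 2 <= d)%N ->
      forall l : nat, (k <= l)%N -> (l <= d - k - 1)%N ->
        gvec d M l.+1 =
          'C(d + 2, l.+1)%:Z *
          \sum_(1 <= i < l.+1) (-1) ^+ (l - i) * (betti F M i)%:Z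
    & (* (d) *)
      (2 * k + 2 <= d)%N ->
      forall i : nat, (k + 1 <= i)%N -> (i <= d - k - 1)%N ->
        betti F M i = 0%N].
Proof.
have [_ HM dimM _ HL] := M_in_W; have dM := proj2 HM.
have [x0 x0V] := vertices_neq0 dimM.
have D1 := alt_betti1_eq0 F HM M_2nbly x0V.
have Cgt0 l : (l + k < d)%N -> 0 < 'C(d + 2, l.+1)%:R :> rat.
  by move=> lkd; rewrite ltr0n bin_gt0; lia.
have le_g l : (l + k < d)%N ->
    (alt_betti F l.+1 M)%:~R <= (gvec d M l.+1)%:~R / 'C(d + 2, l.+1)%:R :> rat.
  by move=> lkd; apply: alt_betti_le_gvec lkd HL.
have ineq l : (l + k < d)%N -> gvec d M l.+1 >= 'C(d + 2, l.+1)%:Z *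
    \sum_(1 <= i < l.+1) (-1) ^+ (l - i) * (betti F M i)%:Z.
  move=> lkd; rewrite -alt_betti_sum // -(ler_int rat) intrM mulrC.
  by rewrite -ler_pdivlMr ?Cgt0 // le_g.
(* Two consecutive bounds add up to an inequality between 0 and a Betti number. *)
have pair l : (k <= l)%N -> (l.+1 + k < d)%N ->
    [/\ (alt_betti F l.+1 M)%:~R = (gvec d M l.+1)%:~R / 'C(d + 2, l.+1)%:R :> rat,
        (alt_betti F l.+2 M)%:~R = (gvec d M l.+2)%:~R / 'C(d + 2, l.+2)%:R :> rat
      & betti F M l.+1 = 0%N].
  move=> kl lkd; have h1 := le_g l ltac:(lia); have h2 := le_g l.+1 lkd.
  have h3 := @gvec_consecutive M HM k d l.+1 ltac:(lia) ltac:(lia) HL.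
  have h4 : 0 <= (alt_betti F l.+1 M)%:~R + (alt_betti F l.+2 M)%:~R :> rat.
    by rewrite -intrD ler0z alt_betti_recr_ge0.
  have e1 : (alt_betti F l.+1 M)%:~R = (gvec d M l.+1)%:~R / 'C(d + 2, l.+1)%:R :> rat by lra.
  have e2 : (alt_betti F l.+2 M)%:~R = (gvec d M l.+2)%:~R / 'C(d + 2, l.+2)%:R :> rat by lra.
  split=> //; apply/eqP; rewrite -eqz_nat bettiE // -(intr_eq0 rat) intrD e1 e2.
  by rewrite h3.
split=> [dk l _ lk|kd l _ lk|kd l kl ld|kd [|l] kl ld].
(* In cases (a) and (b) the bounds on [l] give [l + k < d]. *)
- by apply: ineq; lia.
- by apply: ineq; lia.
- have lkd : (l + k < d)%N by lia.
  suff e : (alt_betti F l.+1 M)%:~R = (gvec d M l.+1)%:~R / 'C(d + 2, l.+1)%:R :> rat.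
    apply: (@intr_inj rat); rewrite -alt_betti_sum // intrM mulrC e.
    by rewrite divfK // gt_eqF ?Cgt0.
  have [lk2|lk2] := ltnP (l.+1 + k) d; first by case: (pair l).
  (* At the top value [l = d - k - 1] the equality is the second half of the pair one degree lower,
     admissible because [d >= 2k + 2]. *)
  by case: l kl ld lkd lk2 => [|l] kl ld lkd lk2; [lia | case: (pair l) => //; lia].
- by lia.
- by case: (pair l) => //; lia.
Qed.
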